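(* Let $\Omega\subset\mathbb{R}^n$ be a bounded polyhedral domain, $\{\mathcal{T}_h\}$ a shape-regular family of simplicial meshes of $\Omega$, and $1\le k\le n$. Let $V_h^{k-1}=\mathcal{P}_1\Lambda^{k-1}(\mathcal{T}_h)$ and $V_h^k=\mathcal{P}_1^-\Lambda^k(\mathcal{T}_h)$, let $\langle\cdot,\cdot\rangle$ be the $L^2$ inner product on forms and $\|\cdot\|$ its norm, and let $$\langle u,v\rangle_h=\sum_{T\in\mathcal{T}_h}\frac{|T|}{n+1}\sum_{x\in\Delta_0(T)}\langle u_x,v_x\rangle_{\mathrm{Alt}},$$ where in the term for $T$ the values $u_x,v_x$ are those of $u|_T,v|_T$ at the vertex $x$. Let $$W_h^{k-1}=\{\tau\in L^2\Lambda^{k-1}(\Omega):\ \tau|_T\in\mathcal{P}_0\Lambda^{k-1}(T)\ \text{for all }T\in\mathcal{T}_h\}.$$ Then the following hold. (A) $\langle\cdot,\cdot\rangle_h$ is a symmetric bounded coercive bilinear form on $V_h^{k-1}\times V_h^{k-1}$, and $\|\tau\|_h:=\langle\tau,\tau\rangle_h^{1/2}$ is equivalent to $\|\tau\|$ for $\tau\in V_h^{k-1}$, with constants independent of $h$. (B) There exist a subspace $\tilde V_h^{k-1}\subset V_h^{k-1}$ such that $\langle\tau,\tau_0\rangle=\langle\tau,\tau_0\rangle_h$ for all $\tau\in\tilde V_h^{k-1}$, $\tau_0\in W_h^{k-1}$, and a linear map $\Pi_h:V_h^{k-1}\to\tilde V_h^{k-1}$ such that, for all $\tau\in V_h^{k-1}$,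 $d\Pi_h\tau=d\tau$, $\|\Pi_h\tau\|\le C\|\tau\|$ with $C$ independent of $h$, and $\langle\Pi_h\tau,\tau_0\rangle_h=\langle\tau,\tau_0\rangle_h$ for all $\tau_0\in W_h^{k-1}$.
   Context: $\mathrm{Alt}^j(\mathbb{R}^n)$ is the space of alternating $j$-linear forms on $\mathbb{R}^n$ with inner product $\langle a,b\rangle_{\mathrm{Alt}}=\sum a(e_{\sigma_1},\dots,e_{\sigma_j})b(e_{\sigma_1},\dots,e_{\sigma_j})$, the sum over $1\le\sigma_1<\dots<\sigma_j\le n$, for an orthonormal basis $(e_i)$ of $\mathbb{R}^n$. $L^2\Lambda^j(\Omega)$ is the space of square integrable $j$-forms with $\langle u,v\rangle=\int_\Omega\langle u_x,v_x\rangle_{\mathrm{Alt}}\,dx$; $H\Lambda^j(\Omega)$ is the subspace of $u$ with exterior derivative $du\in L^2\Lambda^{j+1}(\Omega)$. The parameter $h$ is the maximal diameter of the simplices of $\mathcal{T}_h$. $\Delta_0(T)$ is the set of vertices of $T$, and $|T|$ the volume. $\mathcal{P}_r\Lambda^j(T)$ is the space of $j$-forms on $T$ with polynomial coefficients of degree at most $r$. $\mathcal{P}_1\Lambda^{j}(\mathcal{T}_h)$ is the space of $u\in H\Lambda^{j}(\Omega)$ with $u|_T\in\mathcal{P}_1\Lambda^{j}(T)$ for all $T\in\mathcal{T}_h$ (i.e. piecewise linear forms with continuous traces across $(n-1)$-dimensional faces). $\mathcal{P}_1^-\Lambda^j(\mathcal{T}_h)$ is the space of Whitney forms: $u\in H\Lambda^j(\Omega)$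 with $u|_T\in\mathcal{P}_0\Lambda^j(T)+\kappa\mathcal{P}_0\Lambda^{j+1}(T)$, where $(\kappa u)_x=u_x\lrcorner x$ is contraction with the position vector. (The form $\langle\cdot,\cdot\rangle_h$ enters the perturbed mixed method with bilinear form $\mathcal{B}_h(\tau,v,q;\tau',v',q')=\langle\tau,\tau'\rangle_h-\langle d\tau',v\rangle+\langle d\tau,v'\rangle+\langle dv,dv'\rangle+\langle q,v'\rangle-\langle q',v\rangle$ on $V_h^{k-1}\times V_h^k\times\mathfrak{H}_h^k$, where $\mathfrak{H}_h^k=\{v\in V_h^k: dv=0,\ \langle v,d\tau\rangle=0\ \forall\tau\in V_h^{k-1}\}$.) *)

(* Defs.v *)
From HB Require Import structures.
From mathcomp Require Import all_boot all_order all_algebra finmap.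
From mathcomp Require Import all_classical all_reals all_analysis.

Set Implicit Arguments.
Unset Strict Implicit.
Unset Printing Implicit Defensive.

Import Order.TTheory GRing.Theory Num.Theory.
Import numFieldNormedType.Exports.

Local Open Scope classical_set_scope.
Local Open Scope ring_scope.

(** * Lebesgue measure on R^n *)

Definition measure_rV_display : measure_display. Proof. by constructor. Qed.

(* The product sigma-algebra, generated by the coordinate functions; since R is
   second countable this is the Borel sigma-algebra of R^n. *)
Section measurable_rV.
Context {R : realType} {n : nat}.

Let coord (i : 'I_n) (x : 'rV[R]_n) : measurableTypeR R := x 0 i.

Let rV_set0 : g_sigma_preimage coord set0.
Proof. exact: sigma_algebra0. Qed.

Let rV_setC A : g_sigma_preimage coord A -> g_sigma_preimage coord (~` A).
Proof. exact: sigma_algebraC. Qed.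

Let rV_bigcup (F : (set 'rV[R]_n)^nat) : (forall i, g_sigma_preimage coord (F i)) ->
  g_sigma_preimage coord (\bigcup_i F i).
Proof. exact: sigma_algebra_bigcup. Qed.

HB.instance Definition _ := @isMeasurable.Build measure_rV_display
  'rV[R]_n (g_sigma_preimage coord) rV_set0 rV_setC rV_bigcup.

Lemma measurable_coord (i : 'I_n) :
  measurable_fun setT (fun x : 'rV[R]_n => x 0 i : measurableTypeR R).
Proof.
move=> _ Y mY; rewrite setTI; apply: sub_sigma_algebra => /=.
rewrite -bigcup_seq/=; exists i => /=; first by rewrite mem_index_enum.
by exists Y => //; rewrite setTI.
Qed.

Lemma measurable_fun_rVP d (T : measurableType d) (f : T -> 'rV[R]_n) :
  (forall i, measurable_fun setT (fun x => f x 0 i : measurableTypeR R)) ->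
  measurable_fun setT f.
Proof.
move=> mf _ A mA; rewrite setTI.
move: mA => /(_ (fun B => measurable (f @^-1` B))); apply; split.
  split => //=.
  - by rewrite preimage_set0; exact: measurable0.
  - by move=> B mB; rewrite setTD preimage_setC; exact: measurableC.
  - by move=> F mF; rewrite preimage_bigcup; exact: bigcup_measurable.
move=> B; rewrite -bigcup_seq => -[i _ [Y mY <-]] /=.
by rewrite setTI -[_ @^-1` _]setTI; exact: (mf i).
Qed.

End measurable_rV.

Section cons_rV.
Context (R : realType) (n : nat).
Implicit Types (p : measurableTypeR R * 'rV[R]_n) (x : 'rV[R]_n.+1).

Definition cons_rV p : 'rV[R]_n.+1 := row_mx (p.1 : R)%:M p.2.

Definition uncons_rV x : measurableTypeR R * 'rV[R]_n :=
  (x 0 0, \row_i x 0 (lift ord0 i)).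

Lemma cons_rV0 p : cons_rV p 0 0 = p.1.
Proof.
rewrite /cons_rV (_ : 0 = lshift n (ord0 : 'I_1)); last exact/val_inj.
by rewrite (row_mxEl (p.1 : R)%:M p.2) mxE eqxx mulr1n.
Qed.

Lemma cons_rVS p i : cons_rV p 0 (lift ord0 i) = p.2 0 i.
Proof.
rewrite /cons_rV (_ : lift ord0 i = rshift 1 i); last exact/val_inj.
by rewrite (row_mxEr (p.1 : R)%:M p.2).
Qed.

Lemma cons_rVK : cancel cons_rV uncons_rV.
Proof.
move=> [a b]; rewrite /uncons_rV cons_rV0; congr pair.
by apply/rowP => i; rewrite mxE cons_rVS.
Qed.

Lemma measurable_cons_rV : measurable_fun setT cons_rV.
Proof.
apply: measurable_fun_rVP => i; have [k ->|->] := unliftP ord0 i; last first.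
  by under eq_fun do rewrite cons_rV0; exact: measurable_fst.
under eq_fun do rewrite cons_rVS.
exact: (measurableT_comp (measurable_coord k) measurable_snd).
Qed.

Lemma measurable_uncons_rV : measurable_fun setT uncons_rV.
Proof.
apply: measurable_fun_pair; first exact: measurable_coord.
apply: measurable_fun_rVP => i; under eq_fun do rewrite mxE.
exact: measurable_coord.
Qed.

End cons_rV.

Section lebesgue_rVS.
Context (R : realType) (n : nat) (m : {sigma_finite_measure set 'rV[R]_n -> \bar R}).

Definition lebesgue_rVS : set 'rV[R]_n.+1 -> \bar R :=
  pushforward (@lebesgue_measure R \x m)%E (@cons_rV R n).

Let lebesgue_rVS0 : lebesgue_rVS set0 = 0%E.
Proof. by rewrite /lebesgue_rVS /pushforward preimage_set0 measure0. Qed.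

Let lebesgue_rVS_ge0 A : (0 <= lebesgue_rVS A)%E.
Proof. exact: (measure_ge0 (@lebesgue_measure R \x m)%E). Qed.

Let lebesgue_rVS_sigma_additive : semi_sigma_additive lebesgue_rVS.
Proof.
by apply: measure_semi_sigma_additive; exact: measurable_cons_rV.
Qed.

HB.instance Definition _ := isMeasure.Build _ _ _ lebesgue_rVS
  lebesgue_rVS0 lebesgue_rVS_ge0 lebesgue_rVS_sigma_additive.

Let lebesgue_rVS_sigma_finite : sigma_finite setT lebesgue_rVS.
Proof.
have /sigma_finiteP[F [TF ndF Foo]] := sigma_finiteT (@lebesgue_measure R).
have /sigma_finiteP[G [TG ndG Goo]] := sigma_finiteT m.
exists (fun k => @uncons_rV R n @^-1` (F k `*` G k)).
  apply/esym; rewrite -subTset => x _.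
  have [i _ Fi] : (\bigcup_i F i) (uncons_rV x).1 by rewrite -TF.
  have [j _ Gj] : (\bigcup_j G j) (uncons_rV x).2 by rewrite -TG.
  exists (maxn i j) => //; split.
    by move: Fi; apply/subsetPset/ndF/leq_maxl.
  by move: Gj; apply/subsetPset/ndG/leq_maxr.
move=> k; have [mF Fk] := Foo k; have [mG Gk] := Goo k; split.
  rewrite -[X in measurable X]setTI; apply: measurable_uncons_rV => //.
  exact: measurableX.
rewrite /lebesgue_rVS /pushforward -comp_preimage.
rewrite (_ : _ \o _ = id); last by apply/funext => p; exact: cons_rVK.
rewrite preimage_id product_measure1E//.
by rewrite lte_mul_pinfty// ge0_fin_numE.
Qed.

HB.instance Definition _ := Measure_isSigmaFinite.Build _ _ _ lebesgue_rVS
  lebesgue_rVS_sigma_finite.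

End lebesgue_rVS.

Fixpoint lebesgue_rV_rec (R : realType) (n : nat) :
    {sigma_finite_measure set 'rV[R]_n -> \bar R} :=
  match n with
  | 0%N => dirac (0 : 'rV[R]_0)
  | n'.+1 => @lebesgue_rVS R n' (@lebesgue_rV_rec R n')
  end.

Definition lebesgue_rV {R : realType} {n : nat} : set 'rV[R]_n -> \bar R :=
  @lebesgue_rV_rec R n.
HB.instance Definition _ (R : realType) (n : nat) :=
  SigmaFiniteMeasure.on (@lebesgue_rV R n).

(** * Alternating forms *)

Definition multilinear (R : realType) (n j : nat)
    (a : ('I_j -> 'rV[R]_n) -> R) :=
  forall (v : 'I_j -> 'rV[R]_n) i c x y,
    a (dfwith v i (c *: x + y)) = c * a (dfwith v i x) + a (dfwith v i y).

Definition alternating_map (R : realType) (n j : nat)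
    (a : ('I_j -> 'rV[R]_n) -> R) :=
  forall (v : 'I_j -> 'rV[R]_n) i k, i != k -> v i = v k -> a v = 0.

Section alt.
Context (R : realType) (n j : nat).

Definition alt_pred : {pred ('I_j -> 'rV[R]_n) -> R^o} :=
  mem [set a | multilinear a /\ alternating_map a].

Lemma alt_submod_closed : submod_closed alt_pred.
Proof.
split=> [|c a b]; rewrite !inE.
  by split=> [v i d x y|v i k _ _] //=; rewrite mulr0 addr0.
move=> [aM aA] [bM bA]; split=> [v i d x y|v i k ik vik].
  rewrite !(fctE, scalrfctE) /= aM bM.
  by rewrite /GRing.scale/= !mulrDr addrACA mulrCA.
by rewrite !(fctE, scalrfctE) /= (aA v i k)// (bA v i k)// scaler0 addr0.
Qed.

HB.instance Definition _ := GRing.isSubmodClosed.Build R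
  (('I_j -> 'rV[R]_n) -> R^o) alt_pred alt_submod_closed.

Record alt := Alt {
  alt_fun :> ('I_j -> 'rV[R]_n) -> R^o ;
  alt_funP : alt_fun \in alt_pred }.

HB.instance Definition _ := [isSub for alt_fun].
HB.instance Definition _ := [Choice of alt by <:].
HB.instance Definition _ := [SubChoice_isSubLmodule of alt by <:].

End alt.

Definition alt_basis_vec (R : realType) (n j : nat) (s : 'I_j -> 'I_n) :
  'I_j -> 'rV[R]_n := fun i => delta_mx 0 (s i).

(* The sum over the indices s_1 < ... < s_j, for the standard basis of R^n. *)
Definition alt_dot (R : realType) (n j : nat) (a b : alt R n j) : R :=
  \sum_(s : {ffun 'I_j -> 'I_n} |
        [forall i : 'I_j, forall k : 'I_j, (i < k)%N ==> (s i < s k)%N])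
    a (alt_basis_vec R s) * b (alt_basis_vec R s).

Definition vcons (R : realType) (n j : nat) (x : 'rV[R]_n)
    (v : 'I_j -> 'rV[R]_n) : 'I_j.+1 -> 'rV[R]_n :=
  fun i => if unlift ord0 i is Some k then v k else x.

Lemma vcons_dfwith (R : realType) (n j : nat) (x : 'rV[R]_n)
    (v : 'I_j -> 'rV[R]_n) i y :
  vcons x (dfwith v i y) = dfwith (vcons x v) (lift ord0 i) y.
Proof.
apply/funext => k; rewrite /vcons; have [l ->|->] := unliftP ord0 k.
  have [->|il] := eqVneq i l; first by rewrite !dfwithin.
  by rewrite !dfwithout// ?liftK// (inj_eq lift_inj).
by rewrite dfwithout ?unlift_none// eq_sym neq_lift.
Qed.

Lemma contract_subproof (R : realType) (n j : nat) (a : alt R n j.+1) x :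
  (fun v : 'I_j -> 'rV[R]_n => a (vcons x v) : R^o) \in @alt_pred R n j.
Proof.
have := alt_funP a; rewrite !inE => -[aM aA]; split.
  by move=> v i c y z; rewrite !vcons_dfwith aM.
move=> v i k ik vik; apply: (aA _ (lift ord0 i) (lift ord0 k)).
  by rewrite (inj_eq lift_inj).
by rewrite /vcons !liftK.
Qed.

(* The contraction of a with x, v |-> a(x, v_1, ..., v_j). *)
Definition contract (R : realType) (n j : nat) (a : alt R n j.+1)
  (x : 'rV[R]_n) : alt R n j := Alt (contract_subproof a x).

(** * Differential forms

    A j-form is a function defined on the whole of R^n; only its values on the
    domain matter, and the spaces below are considered modulo equality almost
    everywhere on the domain. *)

Notation dform R n j := ('rV[R]_n -> alt R n j).

Section forms.
Context (R : realType) (n : nat) (Om : set 'rV[R]_n).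

Definition L2_form (j : nat) : set (dform R n j) :=
  [set u : dform R n j | (forall v, measurable_fun Om (fun x => u x v : R)) /\
           (\int[lebesgue_rV]_(x in Om) (alt_dot (u x) (u x))%:E < +oo)%E].

Definition form_dot (j : nat) (u v : dform R n j) : R :=
  \int[lebesgue_rV]_(x in Om) alt_dot (u x) (v x).

Definition form_norm (j : nat) (u : dform R n j) : R :=
  Num.sqrt (form_dot u u).

Definition smooth (f : 'rV[R]_n -> R) :=
  forall s : seq 'rV[R]_n,
    let g := foldr (fun v h x => 'D_v h x) f s in
    continuous g /\ forall x v, derivable g x v.

Definition test_function (f : 'rV[R]_n -> R) :=
  let supp := closure [set x | f x != 0] in
  [/\ smooth f, compact supp & supp `<=` Om].

(* w = du in the sense of distributions, where
   (du)_x(v_0, ..., v_j) = \sum_i (-1)^i D_{v_i} u_x(v_0, .. no v_i .., v_j). *)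
Definition weak_ext_deriv (j : nat) (u : dform R n j) (w : dform R n j.+1) :=
  forall (f : 'rV[R]_n -> R) (v : 'I_j.+1 -> 'rV[R]_n), test_function f ->
    \int[lebesgue_rV]_(x in Om) (w x v * f x) =
    - \sum_(i < j.+1) (-1) ^+ i *
        \int[lebesgue_rV]_(x in Om)
          (u x (fun l : 'I_j => v (lift i l)) * 'D_(v i) f x).

Definition HLambda (j : nat) : set (dform R n j) :=
  [set u : dform R n j | L2_form u /\ exists2 w, L2_form w & weak_ext_deriv u w].

(* The exterior derivative du of u in HLambda, unique almost everywhere. *)
Definition ext_deriv (j : nat) (u : dform R n j) : dform R n j.+1 :=
  xget 0 [set w : dform R n j.+1 | L2_form w /\ weak_ext_deriv u w].

Definition ae_eq_form (j : nat) (u v : dform R n j) :=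
  {ae lebesgue_rV, forall x, Om x -> u x = v x}.

(* Polynomial j-forms of degree at most r. *)
Definition poly_form (r j : nat) : set (dform R n j) :=
  [set p : dform R n j | exists c : {ffun 'I_n -> 'I_r.+1} -> alt R n j, forall x,
    p x = \sum_(m : {ffun 'I_n -> 'I_r.+1} | (\sum_i m i <= r)%N)
            (\prod_i x 0 i ^+ m i) *: c m].

(* P_0 Lambda^j + kappa P_0 Lambda^(j+1). *)
Definition whitney_poly_form (j : nat) : set (dform R n j) :=
  [set p : dform R n j | exists (a : alt R n j) (b : alt R n j.+1),
    forall x, p x = a + contract b x].

End forms.
Arguments poly_form {R n} r j.
Arguments whitney_poly_form {R n} j.

(** * Simplicial meshes

    An n-simplex is represented by the finite set of its vertices, and a mesh
    by the finite set of its n-simplices. *)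

Section mesh.
Context (R : realType) (n : nat).
Local Notation pt := 'rV[R]_n.

Definition hull (T : {fset pt}) : set pt :=
  [set y | exists c : pt -> R,
    [/\ forall x, x \in T -> 0 <= c x,
        \sum_(x <- T) c x = 1 & y = \sum_(x <- T) c x *: x]].

Definition affinely_independent (T : {fset pt}) :=
  forall c : pt -> R, \sum_(x <- T) c x = 0 -> \sum_(x <- T) c x *: x = 0 ->
    forall x, x \in T -> c x = 0.

Definition nsimplex (T : {fset pt}) :=
  #|` T|%fset = n.+1 /\ affinely_independent T.

Definition volume (T : {fset pt}) : R := fine (lebesgue_rV (hull T)).

(* A domain is a nonempty connected open set; it is polyhedral when it is the
   interior of a finite union of n-simplices. *)
Definition polyhedral_domain (Om : set pt) :=
  [/\ Om !=set0, open Om, connected Om, bounded_set Om &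
      exists2 K : {fset {fset pt}}, (forall T, T \in K -> nsimplex T) &
        Om = (\bigcup_(T in [set` K]) hull T)°].

(* Conforming: two simplices meet in the common face spanned by their common
   vertices (which may be empty). *)
Definition simplicial_mesh (Om : set pt) (Th : {fset {fset pt}}) :=
  [/\ forall T, T \in Th -> nsimplex T,
      closure Om = \bigcup_(T in [set` Th]) hull T &
      forall S T, S \in Th -> T \in Th ->
        hull S `&` hull T = hull (S `&` T)%fset].

(* The norm of the library on row vectors is the sup norm. *)
Definition enorm (x : pt) : R := Num.sqrt (\sum_i x 0 i ^+ 2).

Definition diam (A : set pt) : R :=
  sup [set r | exists x y, [/\ A x, A y & r = enorm (x - y)]].

Definition inradius (A : set pt) : R :=
  sup [set r | 0 <= r /\
    exists x, forall y, enorm (y - x) <= r -> A y].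

Definition shape_regular (I : Type) (Th : I -> {fset {fset pt}}) :=
  exists gamma : R, forall i T, T \in Th i ->
    diam (hull T) <= gamma * inradius (hull T).

(** * Finite element spaces *)

Definition piecewise (j : nat) (P : set (dform R n j)) (Th : {fset {fset pt}})
    : set (dform R n j) :=
  [set u : dform R n j | forall T, T \in Th -> exists2 p, P p & ae_eq_form (hull T) u p].

(* P_r Lambda^j(T_h). *)
Definition P_Lambda (r j : nat) (Om : set pt) (Th : {fset {fset pt}}) :=
  HLambda (j := j) Om `&` piecewise (poly_form r j) Th.

(* P_1^- Lambda^j(T_h). *)
Definition whitney_Lambda (j : nat) (Om : set pt) (Th : {fset {fset pt}}) :=
  HLambda (j := j) Om `&` piecewise (whitney_poly_form j) Th.

Definition P0_L2_Lambda (j : nat) (Om : set pt) (Th : {fset {fset pt}}) :=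
  L2_form (j := j) Om `&` piecewise (poly_form 0 j) Th.

(* The linear polynomial form equal to u almost everywhere on T, for u
   piecewise linear; it is unique when T is nondegenerate. *)
Definition restr (j : nat) (T : {fset pt}) (u : dform R n j) : dform R n j :=
  xget 0 [set p : dform R n j | poly_form 1 j p /\ ae_eq_form (hull T) u p].

Definition form_dot_h (j : nat) (Th : {fset {fset pt}}) (u v : dform R n j) : R :=
  \sum_(T <- Th) volume T / n.+1%:R *
    \sum_(x <- T) alt_dot (restr T u x) (restr T v x).

Definition form_norm_h (j : nat) (Th : {fset {fset pt}}) (u : dform R n j) : R :=
  Num.sqrt (form_dot_h Th u u).

End mesh.
Arguments P_Lambda {R n} r j Om Th.
Arguments whitney_Lambda {R n} j Om Th.
Arguments P0_L2_Lambda {R n} j Om Th.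

(* Main.v *)
(* On a simplex the integral of an affine function is its vertex mean times the
   volume: the barycentric coordinates sum to 1 and have equal integrals, since
   the affine involution exchanging two vertices preserves the simplex. Hence
   vertex quadrature is exact for a piecewise linear form against a piecewise
   constant one, and (B) holds with V~ = V and Pi the identity.

   For (A), let f be affine on a simplex T. Convexity gives
   int_T f^2 <= |T|/(n+1) sum_v f(v)^2, and f(v) = 2 f((v+y)/2) - f(y), integrated
   over y in T, bounds |T| f(v)^2 by a multiple of int_T f^2 that depends on n
   only, as Lebesgue measure scales by a fixed factor under homotheties. *)

Require Import Defs.
From mathcomp Require Import all_boot all_order all_algebra finmap.
From mathcomp Require Import all_classical all_reals all_analysis.
From mathcomp Require Import perm measurable_realfun ring lra.

Set Implicit Arguments.
Unset Strict Implicit.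
Unset Printing Implicit Defensive.

Import Order.TTheory GRing.Theory Num.Theory.
Import numFieldNormedType.Exports.

Local Open Scope classical_set_scope.
Local Open Scope ring_scope.

(** * Lebesgue measure on R^n *)

(** No determinant formula for changes of variables enters. The measure on R^n is an iterated
    product, so invariance under translations and x -> -x comes by induction, and a Fubini argument
    then gives int f * int (g o L) = int g * int (f o L) for invertible L. Taking for g the
    indicator of a well-understood set (the simplex for the vertex exchange, the unit cube for a
    homothety) fixes the factor by which L changes every integral.

    Vertex values go through a chosen linear representative on each simplex. It is unique when |T|
    is nonzero, and when |T| = 0 the weight kills the term, so positivity of the volume is never
    proved. Splitting an integral over Omega rests on hyperplanes being null, which covers both the
    overlaps of simplices and the boundary of Omega.

    Choosing V~ = V leaves the obligation that V is a linear space. The weak derivative is defined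
    by integrals, which are additive on integrable functions, so every component of an L^2 form, not
    just those in its norm, must be shown integrable. *)

Section lebesgue_rV_theory.
Context {R : realType}.

(** The sigma-algebra is generated by the coordinates, so [U] is written as the countable union of
    the balls with rational centre and radius that it contains. The norm being the sup norm, each
    ball is a finite intersection of coordinate preimages of intervals. *)
Lemma measurable_open_rV n (U : set 'rV[R]_n) : open U -> measurable U.
Proof.
move=> oU.
pose q2r (q : 'rV[rat]_n) : 'rV[R]_n := map_mx (fun z => ratr z) q.
pose B (p : 'rV[rat]_n * rat) : set 'rV[R]_n :=
  if `[< 0 < ratr p.2 :> R /\ ball (q2r p.1) (ratr p.2) `<=` U >] then
    ball (q2r p.1) (ratr p.2) else set0.
have -> : U = \bigcup_p B p.
  apply/seteqP; split => [x Ux|x [p _]]; last first.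
    by rewrite /B; case: asboolP => // -[_]; apply.
  have /nbhs_ballP[e e0 eU] : nbhs x U by exact: open_nbhs_nbhs.
  have [r /[!in_itv]/= /andP[r0 re]] : exists r : rat, (ratr r : R) \in `]0, e / 2[.
    have [|r] := @rat_in_itvoo R 0 (e / 2); first by rewrite divr_gt0.
    by exists r.
  have /choice[q qx] : forall i : 'I_n, exists q, `|x 0 i - ratr q| < ratr r.
    move=> i; have [|s] := @rat_in_itvoo R (x 0 i - ratr r) (x 0 i + ratr r).
      lra.
    by rewrite in_itv/= => /andP[? ?]; exists s; rewrite ltr_norml; apply/andP; split; lra.
  exists (\row_i q i, r) => //; rewrite /B /=.
  have bx : ball (q2r (\row_i q i)) (ratr r) x.
    split=> // i j; rewrite !mxE ord1 /ball/= distrC.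
    exact: qx.
  case: asboolP => // -[]; split=> // y yq; apply: eU.
  rewrite (splitr e); apply: (@ball_triangle _ _ (q2r (\row_i q i))).
    by apply: ball_sym; apply: le_ball bx; exact: ltW.
  by apply: le_ball yq; exact: ltW.
apply: countable_bigcupT_measurable => // p; rewrite /B; case: asboolP => // -[r0 _].
have -> : ball (q2r p.1) (ratr p.2) =
    \bigcap_(i in [set: 'I_n]) ((fun x : 'rV[R]_n => x 0 i) @^-1` ball (q2r p.1 0 i) (ratr p.2)).
  apply/seteqP; split => [x [_ h] i /=|x h].
    by move=> _; exact: h.
  by split=> // i j; rewrite ord1; exact: h.
apply: fin_bigcap_measurable => [|i _]; first exact: finite_finset.
rewrite -[X in measurable X]setTI.
apply: measurable_coord => //.
exact: measurable_ball.
Qed.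

Lemma continuous_measurable_rV n (f : 'rV[R]_n -> R) :
  continuous f -> measurable_fun setT f.
Proof.
move=> cf; apply: (measurability _ (RGenOpens.measurableE R)).
move=> _ [_ [a [b ->] <-]]; rewrite setTI.
by apply: measurable_open_rV; apply: open_comp => // x _; exact: cf.
Qed.

Lemma measurable_fun_addr d (T : measurableType d) n (f g : T -> 'rV[R]_n) :
  measurable_fun setT f -> measurable_fun setT g ->
  measurable_fun setT (fun x => f x + g x).
Proof.
move=> mf mg; apply: measurable_fun_rVP => i; under eq_fun do rewrite mxE.
by apply: measurable_funD; exact: (measurableT_comp (measurable_coord i)).
Qed.

Lemma measurable_fun_mulmx d (T : measurableType d) n m (f : T -> 'rV[R]_n)
    (L : 'M[R]_(n, m)) :
  measurable_fun setT f -> measurable_fun setT (fun x => f x *m L).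
Proof.
move=> mf; apply: measurable_fun_rVP => i; under eq_fun do rewrite mxE.
apply: measurable_sum => j; apply: measurable_funM => //.
exact: (measurableT_comp (measurable_coord j)).
Qed.

(** The image measure agrees with Lebesgue measure on the intervals ]c, d], which determine it. A
    reflection turns such an interval into one closed at the other end, of the same length. *)
Lemma lebesgue_measure_isometry (e b : R) (A : set (measurableTypeR R)) :
  e = 1 \/ e = -1 -> measurable A ->
  lebesgue_measure ((fun x => e * x + b) @^-1` A) = lebesgue_measure A.
Proof.
move=> he mA.
have mf : measurable_fun setT (fun x : measurableTypeR R => e * x + b : measurableTypeR R).
  by apply: measurable_funD => //; apply: measurable_funM.
apply/esym; apply: (@lebesgue_measure_unique R (pushforward lebesgue_measure _)) => //.
move=> _ [[c d]] _ <-; rewrite /= /pushforward.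
case: he => ->.
  have -> : (fun x => 1 * x + b) @^-1` `]c, d] = `]c - b, d - b]%classic.
    by apply/seteqP; split => x /=; rewrite !in_itv/= => /andP[? ?]; apply/andP; split; lra.
  rewrite !lebesgue_measure_itv/= !lte_fin.
  rewrite ltrD2r; case: ifP => // _; congr EFin; lra.
have -> : (fun x => -1 * x + b) @^-1` `]c, d] = `[b - d, b - c[%classic.
  by apply/seteqP; split => x /=; rewrite !in_itv/= => /andP[? ?]; apply/andP; split; lra.
rewrite !lebesgue_measure_itv/= !lte_fin.
rewrite ltrD2l ltrN2; case: ifP => // _; congr EFin; lra.
Qed.

End lebesgue_rV_theory.

Lemma ge0_integral_invariant d (T : measurableType d) (R : realType)
    (mu : {measure set T -> \bar R}) (S : T -> T) (f : T -> \bar R) :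
  measurable_fun setT S ->
  (forall A, measurable A -> mu (S @^-1` A) = mu A) ->
  measurable_fun setT f -> (forall x, 0 <= f x)%E ->
  (\int[mu]_x f (S x) = \int[mu]_x f x)%E.
Proof.
move=> mS Smu mf f0.
rewrite -[LHS]/(\int[mu]_(x in S @^-1` setT) (f \o S) x)%E.
rewrite -(ge0_integral_pushforward mS)//.
by apply: eq_measure_integral => A mA _; exact: Smu.
Qed.

(** * Isometry invariance and linear changes of variables *)

Section lebesgue_rV_invariance.
Context {R : realType}.
Local Open Scope ereal_scope.

Lemma measurable_affine_rV n (e : R) (b : 'rV[R]_n) :
  measurable_fun setT (fun x : 'rV[R]_n => e *: x + b)%R.
Proof.
apply: measurable_fun_rVP => i; under eq_fun do rewrite !mxE.
by apply: measurable_funD => //; apply: measurable_funM => //; exact: measurable_coord.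
Qed.

(** Induction on the dimension through sections: the induction hypothesis absorbs the motion of the
    last coordinates inside the integral, the one-dimensional case that of the first. *)
Lemma lebesgue_rV_isometry n (e : R) (b : 'rV[R]_n) (A : set 'rV[R]_n) :
  (e = 1 \/ e = -1)%R -> measurable A ->
  lebesgue_rV ((fun x => e *: x + b)%R @^-1` A) = lebesgue_rV A.
Proof.
move=> he; elim: n b A => [|n IH] b A mA.
  congr lebesgue_rV; apply/seteqP; split => x /=;
  by rewrite (_ : (_ + _)%R = x)//; apply/rowP => -[].
set S := fun x : 'rV[R]_n.+1 => (e *: x + b)%R.
pose b' : 'rV[R]_n := (\row_i b 0 (lift ord0 i))%R.
have mcA : measurable (@cons_rV R n @^-1` A).
  by rewrite -[X in measurable X]setTI; exact: (@measurable_cons_rV R n).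
pose g x := @lebesgue_rV R n (xsection (@cons_rV R n @^-1` A) x).
have -> : lebesgue_rV A = \int[@lebesgue_measure R]_x g x by [].
transitivity (\int[@lebesgue_measure R]_x g (e * x + b 0 0)%R).
  apply: eq_integral => x _ /=; rewrite /g -[RHS](IH b'); last exact: measurable_xsection.
  congr lebesgue_rV; apply/funext => y; rewrite /xsection/= !inE/=.
  suff -> : S (cons_rV (x, y)) = cons_rV ((e * x + b 0 0)%R, (e *: y + b')%R) by [].
  apply/rowP => i; rewrite [LHS]mxE [X in (X + _)%R]mxE.
  have [k ->|->] := unliftP ord0 i; first by rewrite !cons_rVS/= !mxE.
  by rewrite !cons_rV0.
apply: (@ge0_integral_invariant _ (measurableTypeR R) _ (@lebesgue_measure R)
   (fun x => e * x + b 0 0)%R).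
- by apply: measurable_funD => //; apply: measurable_funM.
- by move=> B mB; exact: lebesgue_measure_isometry.
- exact: measurable_fun_xsection.
- by move=> x; exact: measure_ge0.
Qed.

Lemma ge0_integral_lebesgue_rV_isometry n (e : R) (b : 'rV[R]_n) f :
  (e = 1 \/ e = -1)%R -> measurable_fun setT f -> (forall x, 0 <= f x) ->
  \int[lebesgue_rV]_x f (e *: x + b)%R = \int[@lebesgue_rV R n]_x f x.
Proof.
move=> he mf f0.
apply: (@ge0_integral_invariant _ _ _ (@lebesgue_rV R n) (fun x => e *: x + b)%R) => //.
- exact: measurable_affine_rV.
- by move=> A mA; exact: lebesgue_rV_isometry.
Qed.

Lemma ge0_integral_lebesgue_rV_shift n (b : 'rV[R]_n) f :
  measurable_fun setT f -> (forall x, 0 <= f x) ->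
  \int[lebesgue_rV]_x f (x + b)%R = \int[@lebesgue_rV R n]_x f x.
Proof.
move=> mf f0; rewrite -(ge0_integral_lebesgue_rV_isometry b (or_introl erefl) mf f0).
by apply: eq_integral => x _; rewrite scale1r.
Qed.

Lemma ge0_integral_lebesgue_rVN n (b : 'rV[R]_n) f :
  measurable_fun setT f -> (forall x, 0 <= f x) ->
  \int[lebesgue_rV]_x f (b - x)%R = \int[@lebesgue_rV R n]_x f x.
Proof.
move=> mf f0; rewrite -(ge0_integral_lebesgue_rV_isometry b (or_intror erefl) mf f0).
by apply: eq_integral => x _; rewrite scaleN1r addrC.
Qed.

(* Both sides are the integral of f (x) g (y L + x) over pairs (x, y), by
   translation invariance in one variable and then in the other. *)
Lemma ge0_integral_lebesgue_rV_mulmx n (L : 'M[R]_n) (f g : 'rV[R]_n -> \bar R) :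
  L \in unitmx -> measurable_fun setT f -> measurable_fun setT g ->
  (forall x, 0 <= f x) -> (forall x, 0 <= g x) ->
  (\int[lebesgue_rV]_x f x) * (\int[lebesgue_rV]_x g (x *m L)%R) =
  (\int[lebesgue_rV]_x g x) * (\int[lebesgue_rV]_x f (x *m L)%R).
Proof.
move=> uL mf mg f0 g0.
have mL : measurable_fun setT (fun x : 'rV[R]_n => (x *m L)%R).
  exact: measurable_fun_mulmx.
have mfL : measurable_fun setT (fun x => f (x *m L)%R) by exact: measurableT_comp.
have mgL : measurable_fun setT (fun x => g (x *m L)%R) by exact: measurableT_comp.
have gL x : \int[lebesgue_rV]_y g (y *m L + x)%R = \int[lebesgue_rV]_y g (y *m L)%R.
  rewrite -(ge0_integral_lebesgue_rV_shift (x *m invmx L) mgL)//.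
  by apply: eq_integral => y _; rewrite mulmxDl mulmxKV.
have fL x : \int[lebesgue_rV]_y f (x - y *m L)%R = \int[lebesgue_rV]_y f (y *m L)%R.
  rewrite -(ge0_integral_lebesgue_rVN (x *m invmx L) mfL)//.
  by apply: eq_integral => y _; rewrite mulmxBl mulmxKV.
rewrite -ge0_integralZr//; last exact: integral_ge0.
rewrite -ge0_integralZr//; last exact: integral_ge0.
transitivity (\int[lebesgue_rV]_x \int[lebesgue_rV]_y (f x * g (y *m L + x)%R)).
  apply: eq_integral => x _; rewrite -(gL x) ge0_integralZl//.
  apply: measurableT_comp => //.
  by apply: measurable_fun_addr => //; exact: measurable_cst.
pose F (p : 'rV[R]_n * 'rV[R]_n) := f p.1 * g (p.2 *m L + p.1)%R.
rewrite (@fubini_tonelli _ _ _ _ _ (@lebesgue_rV R n) (@lebesgue_rV R n) F); last 2 first.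
- apply: emeasurable_funM; first exact: measurableT_comp.
  apply: measurableT_comp => //; apply: measurable_fun_addr => //.
  exact: measurable_fun_mulmx.
- by move=> p; rewrite mule_ge0.
pose G (p : 'rV[R]_n * 'rV[R]_n) := f (p.2 - p.1 *m L)%R * g p.2.
transitivity (\int[lebesgue_rV]_y \int[lebesgue_rV]_x G (y, x)).
  apply: eq_integral => y _; rewrite /F /=.
  rewrite -(ge0_integral_lebesgue_rV_shift (- (y *m L))%R).
  - by apply: eq_integral => x _; rewrite /G /= addrCA subrr addr0.
  - apply: emeasurable_funM => //; apply: measurableT_comp => //.
    by apply: measurable_fun_addr => //; exact: measurable_cst.
  - by move=> x; rewrite mule_ge0.
rewrite (@fubini_tonelli _ _ _ _ _ (@lebesgue_rV R n) (@lebesgue_rV R n) G); last 2 first.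
- apply: emeasurable_funM; last exact: measurableT_comp.
  apply: measurableT_comp => //; apply: measurable_fun_addr => //.
  under eq_fun do rewrite -mulmxN; exact: measurable_fun_mulmx.
- by move=> p; rewrite mule_ge0.
apply: eq_integral => x _; rewrite -(fL x) -ge0_integralZl//.
  by apply: eq_integral => y _; rewrite muleC.
apply: measurableT_comp => //; apply: measurable_fun_addr => //.
by under eq_fun do rewrite -mulmxN; exact: measurable_fun_mulmx.
Qed.

End lebesgue_rV_invariance.

(** * Affine maps, homotheties and null hyperplanes *)

Section lebesgue_rV_affine.
Context {R : realType}.
Local Open Scope ereal_scope.

(** A change of variables without determinants: once the map preserves the integral of a single [g],
    finite and nonzero, it preserves that of every [f]. The translation [b] is undone by shifting by
    [b *m invmx L] before [L] acts. *)
Lemma ge0_integral_lebesgue_rV_affine n (L : 'M[R]_n) (b : 'rV[R]_n)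
    (f g : 'rV[R]_n -> \bar R) :
  L \in unitmx -> measurable_fun setT f -> measurable_fun setT g ->
  (forall x, 0 <= f x) -> (forall x, 0 <= g x) ->
  (\int[lebesgue_rV]_x f x) * (\int[lebesgue_rV]_x g (x *m L + b)%R) =
  (\int[lebesgue_rV]_x g x) * (\int[lebesgue_rV]_x f (x *m L + b)%R).
Proof.
move=> uL mf mg f0 g0.
have shift h : measurable_fun setT h -> (forall x, 0 <= h x) ->
    \int[lebesgue_rV]_y h (y *m L + b)%R = \int[lebesgue_rV]_y h (y *m L)%R.
  move=> mh h0; have mhL : measurable_fun setT (fun x => h (x *m L)%R).
    by apply: measurableT_comp => //; exact: measurable_fun_mulmx.
  rewrite -(ge0_integral_lebesgue_rV_shift (b *m invmx L) mhL)//.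
  by apply: eq_integral => y _; rewrite mulmxDl mulmxKV.
by rewrite !shift//; exact: ge0_integral_lebesgue_rV_mulmx.
Qed.

Definition cube n (c : R) : set 'rV[R]_n := [set x | forall i, (0 <= x 0 i <= c)%R].

Lemma measurable_cube n c : measurable (@cube n c).
Proof.
have -> : @cube n c = \bigcap_(i in [set: 'I_n]) ((fun x : 'rV[R]_n => x 0%R i) @^-1` `[0%R, c]).
  by apply/seteqP; split => [x h i _ /=|x h i]; [rewrite in_itv/=; exact: h|
    have := h i I; rewrite /= in_itv].
apply: fin_bigcap_measurable => [|i _]; first exact: finite_finset.
by rewrite -[X in measurable X]setTI; apply: measurable_coord.
Qed.

Lemma lebesgue_rV_cube n c : (0 <= c)%R -> lebesgue_rV (@cube n c) = (c ^+ n)%:E.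
Proof.
move=> c0; elim: n => [|n IH].
  have c00 : @cube 0 c 0%R by case.
  by rewrite /lebesgue_rV/= /dirac/= indicE mem_set// expr0.
have -> : lebesgue_rV (@cube n.+1 c) =
    (@lebesgue_measure R \x @lebesgue_rV R n)%E (`[0%R, c] `*` @cube n c).
  have <- // : @cons_rV R n @^-1` (@cube n.+1 c) = `[0%R, c] `*` @cube n c.
  apply/seteqP; split => [x h|x [h1 h2] i].
    split => /=; first by have := h 0%R; rewrite cons_rV0 in_itv.
    by move=> i; have := h (lift ord0 i); rewrite cons_rVS.
  have [k ->|->] := unliftP ord0 i; first by rewrite cons_rVS; exact: h2.
  by rewrite cons_rV0; move: h1; rewrite /= in_itv.
rewrite product_measure1E//; last exact: measurable_cube.
rewrite [X in _ * X = _]IH.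
rewrite [X in X * _ = _](lebesgue_measure_itv `[0%R, c]%R)/= lte_fin; case: ltgtP c0 => // [c0 _|<- _].
  by rewrite oppr0 adde0 -EFinM exprS.
by rewrite mul0e expr0n.
Qed.

Lemma bounded_set_rV_coord n (A : set 'rV[R]_n) : bounded_set A ->
  exists C : R, forall x i, A x -> (`|x 0 i| <= C)%R.
Proof.
move=> [M [Mreal hM]]; exists (`|M| + 1)%R => x i Ax.
apply: le_trans (hM (`|M| + 1)%R _ x Ax); last by rewrite ltr_pwDr// ler_norm.
rewrite [leRHS]mx_normrE.
exact: (le_bigmax _ (fun ij : 'I_1 * 'I_n => `|x ij.1 ij.2|%R) (0%R, i)).
Qed.

Lemma lebesgue_rV_bounded n (A : set 'rV[R]_n) (C : R) :
  measurable A -> (forall x i, A x -> (`|x 0 i| <= C)%R) -> lebesgue_rV A < +oo.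
Proof.
move=> mA AC.
(* Translated by |C| in every coordinate, [A] lies in the cube of side 2|C|. *)
rewrite -(lebesgue_rV_isometry (const_mx (- `|C|))%R (or_introl erefl) mA).
apply: (@le_lt_trans _ _ (lebesgue_rV (@cube n (`|C| + `|C|)%R))).
  apply: le_measure; rewrite ?inE.
  - rewrite -[X in measurable X]setTI; exact: measurable_affine_rV.
  - exact: measurable_cube.
  - move=> x /= Ax i; have := AC _ i Ax; rewrite !mxE mul1r.
    move=> /le_trans/(_ (ler_norm _)); rewrite ler_norml => /andP[? ?].
    by apply/andP; split; lra.
by rewrite lebesgue_rV_cube ?ltry// addr_ge0.
Qed.

(** Compares [f] with the indicator of the unit cube: [K] is the measure of the preimage of the cube
    under scaling by [a]. It is chosen before [b] and [f], which is what later makes the stability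
    constant independent of the simplex. *)
Lemma lebesgue_rV_homothety n (a : R) : a != 0%R -> exists K : R,
  forall (b : 'rV[R]_n) (f : 'rV[R]_n -> \bar R),
  measurable_fun setT f -> (forall x, 0 <= f x) ->
  \int[lebesgue_rV]_x f (a *: x + b)%R = K%:E * \int[lebesgue_rV]_x f x.
Proof.
move=> a0; pose S x : 'rV[R]_n := (a *: x)%R.
have mS : measurable_fun setT S.
  by have := measurable_affine_rV a (0 : 'rV[R]_n)%R; under eq_fun do rewrite addr0.
have SE x b : (a *: x + b)%R = (x *m a%:M + b)%R by rewrite mul_mx_scalar.
have mSc : measurable (S @^-1` @cube n 1).
  by rewrite -[X in measurable X]setTI; apply: mS => //; exact: measurable_cube.
exists (fine (lebesgue_rV (S @^-1` @cube n 1))) => b f mf f0.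
rewrite fineK; last first.
  rewrite ge0_fin_numE; last exact: measure_ge0.
  apply: (@lebesgue_rV_bounded _ _ `|a|^-1%R) => // x i /(_ i); rewrite mxE => /andP[h0 h1].
  rewrite -[leRHS]mulr1 ler_pdivlMl ?normr_gt0// -normrM ger0_norm//.
have m1 : measurable_fun setT (fun x : 'rV[R]_n => (\1_(@cube n 1) x : R)%:E).
  by apply/measurable_EFinP; apply: measurable_indic; exact: measurable_cube.
have uL : (a%:M : 'M[R]_n) \in unitmx.
  by rewrite unitmxE det_scalar unitrX// unitfE.
have mfS : measurable_fun setT (f \o S) by exact: measurableT_comp.
transitivity (\int[lebesgue_rV]_x f (x *m a%:M)%R).
  under [RHS]eq_integral do rewrite mul_mx_scalar.
  rewrite -(ge0_integral_lebesgue_rV_shift (a^-1 *: b)%R mfS); last by move=> x; exact: f0.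
  by apply: eq_integral => x _; rewrite /= /S scalerDr scalerA divff// scale1r.
have c1_ge0 x : 0 <= (\1_(@cube n 1) x : R)%:E by rewrite lee_fin.
have := ge0_integral_lebesgue_rV_mulmx uL mf m1 f0 c1_ge0.
have -> : \int[lebesgue_rV]_x (\1_(@cube n 1) x : R)%:E = 1.
  rewrite (integral_indic _ measurableT (@measurable_cube n 1)) setIT.
  by apply: etrans (lebesgue_rV_cube n ler01) _; rewrite expr1n.
rewrite mul1e => <-.
rewrite muleC; congr (_ * _).
under eq_integral do rewrite mul_mx_scalar.
transitivity (\int[lebesgue_rV]_x (\1_(S @^-1` @cube n 1) x : R)%:E).
  by apply: eq_integral => x _; rewrite !indicE.
by rewrite (integral_indic _ measurableT mSc) setIT.
Qed.

(** The parallel hyperplanes are translates of each other along [w], so they share one measure m.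
    Measuring the set of pairs (x, t) with [phi x = t] by Fubini gives 0 when t is integrated first,
    its sections being points, and m times the length of the real line in the other order; hence m =
    0. *)
Lemma lebesgue_rV_hyperplane n (u : 'cV[R]_n) (c : R) : u != 0%R ->
  lebesgue_rV [set x : 'rV[R]_n | (x *m u) 0%R 0%R = c] = 0.
Proof.
move=> u0; pose phi (x : 'rV[R]_n) := ((x *m u) 0 0)%R.
have mphi : measurable_fun setT phi.
  apply: (measurableT_comp (measurable_coord 0%R)).
  exact: measurable_fun_mulmx.
have phiD x y : phi (x + y)%R = (phi x + phi y)%R by rewrite /phi mulmxDl mxE.
have phiZ a x : phi (a *: x)%R = (a * phi x)%R by rewrite /phi -scalemxAl mxE.
pose H t := [set x | phi x = t].
have mH t : measurable (H t).
  rewrite -[X in measurable X]setTI.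
  exact: (mphi measurableT [set t] (measurable_set1 t)).
have [w w1] : exists w, phi w = 1%R.
  have [i ui] : exists i, u i 0%R != 0%R.
    apply/existsP; rewrite -negb_forall; apply: contra u0 => /forallP h.
    by apply/eqP/colP => i; rewrite mxE; exact/eqP.
  exists ((u i 0)^-1 *: delta_mx 0 i)%R.
  by rewrite /phi -scalemxAl -rowE !mxE mulVf.
have Ht t : lebesgue_rV (H t) = lebesgue_rV (H c).
  rewrite -(lebesgue_rV_isometry ((t - c) *: w)%R (or_introl erefl) (mH t)).
  congr lebesgue_rV; apply/seteqP; split => x; rewrite /H/= scale1r phiD phiZ w1 mulr1; lra.
pose F (p : 'rV[R]_n * measurableTypeR R) : \bar R := (\1_[set 0%R] (phi p.1 - p.2))%:E.
have mF : measurable_fun setT F.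
  apply/measurable_EFinP; apply: measurableT_comp; first exact: measurable_indic.
  by apply: measurable_funB => //; exact: measurableT_comp.
have F0 p : 0 <= F p by rewrite lee_fin.
have := @fubini_tonelli _ _ _ _ _ (@lebesgue_rV R n) (@lebesgue_measure R) F mF F0.
have Fx x : \int[@lebesgue_measure R]_y F (x, y) = 0.
  transitivity (\int[@lebesgue_measure R]_y (\1_[set phi x] y : R)%:E).
    apply: eq_integral => y _; rewrite /F/= !indicE; congr (_%:R%:E); congr nat_of_bool.
    by apply: asbool_equiv_eq => /=; split => [/subr0_eq|->]; rewrite ?subrr.
  rewrite (integral_indic (@lebesgue_measure R) measurableT (measurable_set1 (phi x))).
  by rewrite setIT; exact: lebesgue_measure_set1.
have Fy y : \int[@lebesgue_rV R n]_x F (x, y) = lebesgue_rV (H c).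
  rewrite -(Ht y) -[in RHS](setIT (H y)) -(integral_indic _ measurableT (mH y)).
  apply: eq_integral => x _; rewrite /F/= !indicE; congr (_%:R%:E); congr nat_of_bool.
  by apply: asbool_equiv_eq => /=; split => [/subr0_eq|->]; rewrite ?subrr.
under eq_integral do rewrite Fx.
rewrite integral0; under eq_integral do rewrite Fy.
rewrite integral_cst// => /esym/eqP; rewrite mule_eq0 => /orP[/eqP//|].
suff : (0%R : \bar R) < @lebesgue_measure R setT by move=> /gt_eqF ->.
apply: (@lt_le_trans _ _ (@lebesgue_measure R `[0%R, 1%R])).
  by rewrite lebesgue_measure_itv/= lte_fin ltr01 oppr0 adde0 lte_fin.
by apply: le_measure; rewrite ?inE.
Qed.

End lebesgue_rV_affine.

(** * Affine functions and barycentric coordinates *)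

Section affine_functions.
Context {R : realType} {n : nat}.
Implicit Types (f : 'rV[R]_n -> R) (x y z : 'rV[R]_n).

Definition affine_fun f := exists (u : 'cV[R]_n) (c : R),
  forall x, f x = (x *m u) 0 0 + c.

Lemma affine_fun_cst c : affine_fun (fun=> c).
Proof. by exists 0; exists c => x; rewrite mulmx0 mxE add0r. Qed.

Lemma affine_fun_coord i : affine_fun (fun x => x 0 i).
Proof.
exists (delta_mx i 0); exists 0 => x; rewrite addr0 mxE (bigD1 i)//= mxE !eqxx mulr1.
by rewrite big1 ?addr0// => j ji; rewrite mxE (negbTE ji) mulr0.
Qed.

Lemma affine_funD f g : affine_fun f -> affine_fun g ->
  affine_fun (fun x => f x + g x).
Proof.
move=> [u [c fE]] [v [d gE]]; exists (u + v); exists (c + d) => x.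
by rewrite fE gE mulmxDr [in RHS]mxE addrACA.
Qed.

Lemma affine_funZ a f : affine_fun f -> affine_fun (fun x => a * f x).
Proof.
by move=> [u [c fE]]; exists (a *: u); exists (a * c) => x; rewrite fE -scalemxAr [in RHS]mxE mulrDr.
Qed.

Lemma affine_fun_sum (J : Type) (r : seq J) (P : pred J) (F : J -> 'rV[R]_n -> R) :
  (forall j, P j -> affine_fun (F j)) ->
  affine_fun (fun x => \sum_(j <- r | P j) F j x).
Proof.
move=> FA; elim: r => [|j r IH].
  have -> : (fun x => \sum_(j <- [::] | P j) F j x) = fun=> 0.
    by apply/funext => x; rewrite big_nil.
  exact: affine_fun_cst.
have -> : (fun x => \sum_(i <- j :: r | P i) F i x) =
    (fun x => (if P j then F j x else 0) + \sum_(i <- r | P i) F i x).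
  by apply/funext => x; rewrite [LHS]big_cons; case: ifP => // _; rewrite add0r.
apply: affine_funD => //; case Pj: (P j); first exact: FA.
exact: affine_fun_cst.
Qed.

Lemma affine_funE f x y z t : affine_fun f ->
  f (x + t *: (y - z)) = f x + t * (f y - f z).
Proof.
move=> [u [c fE]]; rewrite !fE mulmxDl -scalemxAl mulmxBl.
set a := x *m u; set b := y *m u; set d := z *m u; rewrite !mxE; ring.
Qed.

Lemma affine_fun_comb (J : finType) f (c : J -> R) (v : J -> 'rV[R]_n) :
  affine_fun f -> \sum_j c j = 1 -> f (\sum_j c j *: v j) = \sum_j c j * f (v j).
Proof.
move=> [u [d fE]] c1; rewrite fE mulmx_suml summxE -[d]mul1r -c1 mulr_suml -big_split/=.
by apply: eq_bigr => j _; rewrite fE -scalemxAl [in LHS]mxE mulrDr.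
Qed.

Lemma measurable_affine_fun f : affine_fun f -> measurable_fun setT f.
Proof.
move=> [u [c fE]]; rewrite (funext fE); apply: measurable_funD => //.
apply: (measurableT_comp (measurable_coord 0)).
exact: measurable_fun_mulmx.
Qed.

Lemma continuous_affine_fun f : affine_fun f -> continuous f.
Proof.
move=> [u [c fE]].
have -> : f = (fun x => \sum_i x 0 i * u i 0 + c).
  by apply/funext => x; rewrite fE mxE.
move=> x; apply: (@continuousD _ _ _ (fun x => \sum_i x 0 i * u i 0) (fun=> c)).
  apply: continuous_big => [|i _ y]; first exact: add_continuous.
  apply: (@continuousM _ _ (fun x : 'rV[R]_n => x 0 i) (fun=> u i 0)).
    exact: coord_continuous.
  exact: cst_continuous.
exact: cst_continuous.
Qed.

Lemma affine_fun_level0 f c x : affine_fun f -> f x != c ->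
  lebesgue_rV [set z | f z = c] = 0%E.
Proof.
move=> [u [d fE]] fxc; have [u0|u0] := eqVneq u 0.
  rewrite (_ : [set _ | _] = set0) ?measure0//; apply/seteqP; split => // z /= fz.
  by move: fxc; rewrite -fz !fE u0 !mulmx0 eqxx.
rewrite -[RHS](lebesgue_rV_hyperplane (c - d) u0); congr lebesgue_rV.
by apply/seteqP; split => z /=; rewrite fE => h; lra.
Qed.

End affine_functions.

Section barycentric.
Context {R : realType} {n : nat}.
Implicit Types (T : {fset 'rV[R]_n}) (x y : 'rV[R]_n).

Definition vertex T (i : nat) : 'rV[R]_n := nth 0 (enum_fset T) i.

(** Homogeneous coordinates: the prefixed 1 turns affine combinations into linear ones, so that the
    barycentric coordinates solve one square linear system whose rows are the lifted vertices. *)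
Definition homog x : 'rV[R]_(1 + n) := row_mx 1%:M x.

Definition bary_mx T : 'M[R]_(1 + n) := \matrix_(i < 1 + n) homog (vertex T i).

Definition bary T (i : 'I_n.+1) x : R := (homog x *m invmx (bary_mx T)) 0 i.

Lemma sum_vertices T (V : zmodType) (F : 'rV[R]_n -> V) : nsimplex T ->
  \sum_(x <- T) F x = \sum_(i < n.+1) F (vertex T i).
Proof. by move=> [sT _]; rewrite (big_nth 0) -[in RHS]sT big_mkord. Qed.

Lemma vertex_in T (i : 'I_n.+1) : nsimplex T -> vertex T i \in T.
Proof. by move=> [sT _]; apply: mem_nth; rewrite -[X in (_ < X)%N]/(#|` T|%fset) sT. Qed.

Lemma vertexP T x : nsimplex T -> x \in T -> exists i : 'I_n.+1, x = vertex T i.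
Proof.
move=> [sT _] xT; have iT : (index x (enum_fset T) < n.+1)%N.
  by rewrite -sT -[X in (_ < X)%N]/(size (enum_fset T)) index_mem.
by exists (Ordinal iT); rewrite /vertex/= nth_index.
Qed.

Lemma index_vertex T (i : 'I_n.+1) : nsimplex T ->
  index (vertex T i) (enum_fset T) = i.
Proof.
move=> [sT _]; have iT : (i < size (enum_fset T))%N.
  by rewrite -[X in (_ < X)%N]/(#|` T|%fset) sT.
exact: index_uniq iT (fset_uniq T).
Qed.

Lemma mul_bary_mx T (c : 'rV[R]_(1 + n)) :
  c *m bary_mx T = row_mx (\sum_i c 0 i)%:M (\sum_(i < n.+1) c 0 i *: vertex T i).
Proof.
rewrite mulmx_sum_row.
under eq_bigr => i _ do rewrite rowK /homog scale_row_mx.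
elim/big_rec3: _ => [|i a b d _ ->]; first by rewrite raddf0 row_mx0.
rewrite add_row_mx; congr row_mx; rewrite raddfD; congr (_ + _).
by rewrite scalemx1.
Qed.

(** A row in the left kernel has coefficients of sum 0 that combine the vertices to 0, which affine
    independence forbids unless the row vanishes. *)
Lemma bary_mx_unit T : nsimplex T -> bary_mx T \in unitmx.
Proof.
move=> sT; have [_ aiT] := sT.
rewrite -row_free_unit -kermx_eq0; apply/rowV0P => c /sub_kermxP.
rewrite mul_bary_mx -[RHS]row_mx0 => /eq_row_mx[c0 cv].
apply/rowP => i; rewrite mxE.
(* Affine independence speaks of coefficients attached to points, so the row is read back through
   the position of a point in the enumeration of [T]. *)
pose C x := c 0 (inord (index x (enum_fset T))).
have CE (j : 'I_n.+1) : C (vertex T j) = c 0 j.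
  by rewrite /C index_vertex// inord_val.
rewrite -CE; apply: aiT; last exact: vertex_in.
- rewrite (sum_vertices _ sT); under eq_bigr do rewrite CE.
  by have /matrixP/(_ 0 0) := c0; rewrite !mxE eqxx mulr1n.
- rewrite (sum_vertices (fun x => C x *: x) sT); under eq_bigr do rewrite CE.
  exact: cv.
Qed.

Lemma bary_sum T x : nsimplex T ->
  \sum_i bary T i x = 1 /\ \sum_i bary T i x *: vertex T i = x.
Proof.
move=> sT; have := mulmxKV (bary_mx_unit sT) (homog x).
rewrite mul_bary_mx => /eq_row_mx[c0 cv]; split=> //.
by have /matrixP/(_ 0 0) := c0; rewrite !mxE eqxx !mulr1n.
Qed.

Lemma bary_comb T (c : 'I_n.+1 -> R) i : nsimplex T -> \sum_j c j = 1 ->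
  bary T i (\sum_j c j *: vertex T j) = c i.
Proof.
move=> sT c1; rewrite /bary.
have -> : homog (\sum_j c j *: vertex T j) = (\row_j c j) *m bary_mx T.
  rewrite mul_bary_mx /homog; congr row_mx.
    by under eq_bigr do rewrite mxE; rewrite c1.
  by apply: eq_bigr => j _; rewrite mxE.
by rewrite mulmxK ?bary_mx_unit// mxE.
Qed.

Lemma bary_vertex T i (j : 'I_n.+1) : nsimplex T -> bary T i (vertex T j) = (i == j)%:R.
Proof.
move=> sT; have := bary_comb (c := fun k => (k == j)%:R) i sT.
rewrite (bigD1 j)//= eqxx big1 ?addr0; last by move=> k /negbTE ->.
rewrite (bigD1 j)//= eqxx scale1r big1 ?addr0; first exact.
by move=> k /negbTE ->; rewrite scale0r.
Qed.

Lemma bary_affine T i : affine_fun (bary T i).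
Proof.
exists (dsubmx (invmx (bary_mx T)) *m delta_mx i 0); exists
  ((usubmx (invmx (bary_mx T)) *m (delta_mx i 0 : 'cV_n.+1)) 0 0) => x.
rewrite /bary -[X in _ *m X](vsubmxK (invmx (bary_mx T))) mul_row_col mul1mx.
by rewrite mxE addrC mulmxA -!colE !mxE.
Qed.

Lemma affine_fun_bary T f x : nsimplex T -> affine_fun f ->
  f x = \sum_i bary T i x * f (vertex T i).
Proof.
move=> sT fA; have [b1 bx] := bary_sum x sT.
by rewrite -(affine_fun_comb _ fA b1) bx.
Qed.

(** Replaces the existential description of the hull by n + 1 closed half-spaces, from which
    measurability, closedness and interior points are read off. *)
Lemma hullE T : nsimplex T -> hull T = [set x | forall i, 0 <= bary T i x].
Proof.
move=> sT; apply/seteqP; split => [x [c [c0 c1 ->]] i|x bx].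
  rewrite (sum_vertices (fun x => c x *: x) sT) bary_comb//.
    by apply: c0; exact: vertex_in.
  by rewrite -(sum_vertices _ sT).
have [b1 bv] := bary_sum x sT.
pose C y := bary T (inord (index y (enum_fset T))) x.
have CE (j : 'I_n.+1) : C (vertex T j) = bary T j x.
  by rewrite /C index_vertex// inord_val.
exists C; split.
- by move=> y yT; exact: bx.
- by rewrite (sum_vertices _ sT); under eq_bigr do rewrite CE.
- rewrite (sum_vertices (fun x => C x *: x) sT); under eq_bigr do rewrite CE.
  by rewrite bv.
Qed.

(** Puts a face that misses a vertex into the hyperplane of the opposite facet; this makes the
    overlap of two mesh simplices a null set. The coefficients on [T'] are extended to [T] by 0. *)
Lemma hull_sub_bary0 T' T (i : 'I_n.+1) x : nsimplex T -> (T' `<=` T)%fset ->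
  vertex T i \notin T' -> hull T' x -> bary T i x = 0.
Proof.
move=> sT T'T iT' [c [_ c1 ->]].
pose C y := if y \in T' then c y else 0.
have -> : \sum_(y <- T') c y *: y = \sum_(y <- T) C y *: y.
  rewrite -(big_fset_incl _ T'T).
    by apply: eq_big_seq => y yT'; rewrite /C yT'.
  by move=> y _ /negbTE yT'; rewrite /C yT' scale0r.
rewrite (sum_vertices (fun x => C x *: x) sT) bary_comb//.
  by rewrite /C (negbTE iT').
rewrite -(sum_vertices _ sT) -(big_fset_incl _ T'T).
  by rewrite -[RHS]c1; apply: eq_big_seq => y yT'; rewrite /C yT'.
by move=> y _ /negbTE yT'; rewrite /C yT'.
Qed.

End barycentric.

(** * Integrals over a simplex *)

Lemma integrable_EFin_sum d (T : measurableType d) (R : realType)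
    (mu : {measure set T -> \bar R}) (D : set T) (J : eqType) (r : seq J)
    (F : J -> T -> R) :
  measurable D -> (forall j, j \in r -> mu.-integrable D (EFin \o F j)) ->
  mu.-integrable D (EFin \o (fun x => \sum_(j <- r) F j x)).
Proof.
move=> mD iF; have := integrable_sum mD r iF.
by apply: eq_integrable => // x _ /=; rewrite sumEFin -big_seq.
Qed.

Lemma Rintegral_sum d (T : measurableType d) (R : realType)
    (mu : {measure set T -> \bar R}) (D : set T) (J : eqType) (r : seq J)
    (F : J -> T -> R) :
  measurable D -> (forall j, j \in r -> mu.-integrable D (EFin \o F j)) ->
  \int[mu]_(x in D) (\sum_(j <- r) F j x) = \sum_(j <- r) \int[mu]_(x in D) F j x.
Proof.
move=> mD; elim: r => [_|j r IH iF].
  rewrite big_nil -[RHS](mul0r (fine (mu D))) -Rintegral_cst//.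
  by apply: eq_Rintegral => x _; rewrite big_nil.
have iFr k : k \in r -> mu.-integrable D (EFin \o F k).
  by move=> kr; apply: iF; rewrite inE kr orbT.
rewrite big_cons -IH// -RintegralD//.
- by apply: eq_Rintegral => x _; rewrite big_cons.
- by apply: iF; rewrite inE eqxx.
- exact: integrable_EFin_sum.
Qed.

Section simplex_integral.
Context {R : realType} {n : nat}.
Implicit Types (T : {fset 'rV[R]_n}) (f g : 'rV[R]_n -> R).
Local Notation mu := (@lebesgue_rV R n).

Lemma bary_hull T i x : nsimplex T -> hull T x -> 0 <= bary T i x <= 1.
Proof.
move=> sT; rewrite hullE// => bx; rewrite bx/=.
have [<- _] := bary_sum x sT.
by rewrite (bigD1 i)//= lerDl sumr_ge0.
Qed.

Lemma affine_hull_le T f x : nsimplex T -> affine_fun f -> hull T x ->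
  `|f x| <= \sum_(j < n.+1) `|f (vertex T j)|.
Proof.
move=> sT fA hx; rewrite (affine_fun_bary x sT fA).
apply: le_trans (ler_norm_sum _ _ _) _; apply: ler_sum => j _.
have /andP[b0 b1] := bary_hull j sT hx.
by rewrite normrM (ger0_norm b0) ler_piMl.
Qed.

Lemma measurable_hull T : nsimplex T -> measurable (hull T).
Proof.
move=> sT; rewrite hullE//.
have -> : [set x | forall i, 0 <= bary T i x] =
    \bigcap_(i in [set: 'I_n.+1]) (bary T i @^-1` `[0, +oo[).
  by apply/seteqP; split => [x h i _ /=|x h i]; [rewrite in_itv/= andbT; exact: h|
    have := h i I; rewrite /= in_itv/= andbT].
apply: fin_bigcap_measurable => [|i _]; first exact: finite_finset.
rewrite -[X in measurable X]setTI.
exact: (measurable_affine_fun (bary_affine T i)).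
Qed.

Lemma hull_coord_le T : nsimplex T ->
  exists C : R, forall x i, hull T x -> `|x 0 i| <= C.
Proof.
move=> sT; exists (\sum_i \sum_(j < n.+1) `|vertex T j 0 i|) => x i hx.
apply: le_trans (affine_hull_le sT (affine_fun_coord i) hx) _.
by rewrite [leRHS](bigD1 i)//= lerDl; apply: sumr_ge0 => k _; apply: sumr_ge0.
Qed.

Lemma hull_lty T : nsimplex T -> (mu (hull T) < +oo)%E.
Proof.
move=> sT; have [C hC] := hull_coord_le sT.
exact: lebesgue_rV_bounded (measurable_hull sT) hC.
Qed.

Lemma volumeE T : nsimplex T -> (volume T)%:E = mu (hull T).
Proof. by move=> sT; rewrite /volume fineK// ge0_fin_numE// hull_lty. Qed.

Lemma volume_ge0 T : 0 <= volume T.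
Proof. exact/fine_ge0/measure_ge0. Qed.

Lemma integrable_hull T f (M : R) : nsimplex T -> measurable_fun setT f ->
  (forall x, hull T x -> `|f x| <= M) -> mu.-integrable (hull T) (EFin \o f).
Proof.
move=> sT mf fM; apply: measurable_bounded_integrable.
- exact: measurable_hull.
- exact: hull_lty.
- exact: measurable_funS mf.
- exists M; split; first exact: num_real.
  by move=> N MN x hx; exact: le_trans (fM x hx) (ltW MN).
Qed.

Lemma integrable_affine T f : nsimplex T -> affine_fun f ->
  mu.-integrable (hull T) (EFin \o f).
Proof.
move=> sT fA; apply: integrable_hull => //; first exact: measurable_affine_fun.
by move=> x; exact: affine_hull_le.
Qed.

Lemma integrable_affineM T f g : nsimplex T -> affine_fun f -> affine_fun g ->
  mu.-integrable (hull T) (EFin \o (fun x => f x * g x)).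
Proof.
move=> sT fA gA.
apply: (@integrable_hull _ _ ((\sum_(j < n.+1) `|f (vertex T j)|) * (\sum_(j < n.+1) `|g (vertex T j)|))) => //.
  by apply: measurable_funM; exact: measurable_affine_fun.
by move=> x hx; rewrite normrM ler_pM// affine_hull_le.
Qed.

Section swap.
Variables (T : {fset 'rV[R]_n}) (i j : 'I_n.+1).
Hypothesis sT : nsimplex T.

(* The affine involution exchanging the vertices i and j. *)
Let S x := x + (bary T i x - bary T j x) *: (vertex T j - vertex T i).

(** Moving along the edge from vertex [i] to vertex [j] changes these two coordinates by opposite
    amounts, and the length of the move is chosen so that they are exchanged. *)
Let bary_S l x : bary T l (S x) = bary T (tperm i j l) x.
Proof.
rewrite /S (affine_funE _ _ _ _ (bary_affine T l)) !bary_vertex//.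
case: tpermP => [->|->|/eqP/negbTE -> /eqP/negbTE ->]; rewrite ?eqxx.
- by case: (eqVneq i j) => [->|_]; rewrite /=; ring.
- by case: (eqVneq j i) => [->|_]; rewrite /=; ring.
- by rewrite subrr mulr0 addr0.
Qed.

Let S_affine : exists (L : 'M[R]_n) b, forall x, S x = x *m L + b.
Proof.
have [ui [ci bi]] := bary_affine T i; have [uj [cj bj]] := bary_affine T j.
exists (1%:M + (ui - uj) *m (vertex T j - vertex T i)).
exists ((ci - cj) *: (vertex T j - vertex T i)) => x.
rewrite /S bi bj mulmxDr mulmx1 -[RHS]addrA; congr (_ + _).
rewrite mulmxA [x *m (_ - _)]mx11_scalar mul_scalar_mx -scalerDl.
congr (_ *: _); rewrite mulmxBr.
set p := x *m ui; set q := x *m uj; rewrite !mxE; ring.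
Qed.

Let S_invol x : S (S x) = x.
Proof.
rewrite {1}/S !bary_S tpermL tpermR /S -addrA -scalerDl.
by rewrite -opprB addNr scale0r addr0.
Qed.

(** [S] preserves the simplex and exchanges the two integrands. Compared with the indicator of the
    simplex, this gives the equality multiplied by |T| on both sides. *)
Lemma integral_bary_eq :
  \int[mu]_(x in hull T) bary T i x = \int[mu]_(x in hull T) bary T j x.
Proof.
have [L [b SE]] := S_affine.
have uL : L \in unitmx.
  (* [S] composed with itself is the identity: at 0 this says that [b *m L + b] vanishes, and then
     at the unit vectors that [L *m L] is the identity matrix. *)
  have b0 : b *m L + b = 0 by rewrite -SE -[b]add0r -[X in X + _](mul0mx _ L) -SE S_invol.
  suff /mulmx1_unit[] : L *m L = 1%:M by [].
  apply/row_matrixP => k; rewrite row1 row_mul rowE -[RHS]S_invol !SE mulmxDl.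
  by rewrite -addrA b0 addr0.
have hS x : hull T (S x) <-> hull T x.
  by rewrite hullE//; split => h l; [have := h (tperm i j l)|have := h (tperm i j l)];
    rewrite bary_S ?tpermK.
have mB l : measurable_fun (hull T) (fun x => (bary T l x)%:E).
  apply/measurable_EFinP; apply: measurable_funS (measurable_affine_fun (bary_affine T l)) => //.
pose f x := ((fun x => (bary T i x)%:E) \_ (hull T)) x.
pose g x := (\1_(hull T) x : R)%:E.
have mf : measurable_fun setT f by apply/(measurable_restrictT _ (measurable_hull sT)); exact: mB.
have mg : measurable_fun setT g.
  by apply/measurable_EFinP; apply: measurable_indic; exact: measurable_hull.
have f0 x : (0 <= f x)%E.
  rewrite /f patchE; case: ifPn => // /set_mem hx; rewrite lee_fin.
  by have /andP[] := bary_hull i sT hx.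
have g0 x : (0 <= g x)%E by rewrite lee_fin.
have := ge0_integral_lebesgue_rV_affine b uL mf mg f0 g0.
have -> : (\int[mu]_x g (x *m L + b)%R = \int[mu]_x g x)%E.
  apply: eq_integral => x _; rewrite -SE /g !indicE; congr (_%:R%:E); congr nat_of_bool.
  exact: asbool_equiv_eq.
have -> : (\int[mu]_x g x = (volume T)%:E)%E.
  by rewrite (integral_indic mu measurableT (measurable_hull sT)) setIT volumeE.
have -> : (\int[mu]_x f (x *m L + b)%R = \int[mu]_(x in hull T) (bary T j x)%:E)%E.
  rewrite [RHS]integral_mkcond; apply: eq_integral => x _; rewrite -SE /f !patchE.
  rewrite bary_S tpermL; suff -> : (S x \in hull T) = (x \in hull T) by [].
  exact: asbool_equiv_eq.
rewrite -[(\int[mu]_x f x)%E]integral_mkcond muleC.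
have fin l : (\int[mu]_(x in hull T) (bary T l x)%:E)%E \is a fin_num.
  apply: integrable_fin_num; first exact: measurable_hull.
  exact: integrable_affine (bary_affine T l).
(* The factor |T| cancels if it is nonzero; otherwise both integrals run over a null set. *)
have [v0 _|v0] := eqVneq (volume T) 0.
  have mu0 : mu (hull T) = 0%E by rewrite -volumeE// v0.
  have mT := measurable_hull sT.
  by congr fine; rewrite !null_set_integral.
move=> /(congr1 fine); rewrite !fineM//= => /(mulfI v0).
exact.
Qed.

End swap.

Lemma integral_affine T f : nsimplex T -> affine_fun f ->
  \int[mu]_(x in hull T) f x = volume T / n.+1%:R * \sum_(x <- T) f x.
Proof.
move=> sT fA; have mT := measurable_hull sT.
have iB l := integrable_affine sT (bary_affine T l).
have bE i : \int[mu]_(x in hull T) bary T i x = volume T / n.+1%:R.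
  have : \sum_(j < n.+1) \int[mu]_(x in hull T) bary T j x = volume T.
    rewrite -Rintegral_sum; [|by []|by move=> j _; exact: iB].
    rewrite -[RHS]mul1r -Rintegral_cst//.
    by apply: eq_Rintegral => x _; have [-> _] := bary_sum x sT.
  under eq_bigr do rewrite (integral_bary_eq _ i sT).
  rewrite sumr_const card_ord => <-.
  by rewrite -[X in X / _]mulr_natr mulfK.
rewrite (sum_vertices f sT) mulr_sumr.
transitivity (\int[mu]_(x in hull T) (\sum_(i < n.+1) f (vertex T i) * bary T i x)).
  apply: eq_Rintegral => x _; rewrite (affine_fun_bary x sT fA).
  by apply: eq_bigr => i _; rewrite mulrC.
rewrite Rintegral_sum//; last by move=> i _; exact: (integrableZl mT _ (iB i)).
by apply: eq_bigr => i _; rewrite RintegralZl// bE mulrC.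
Qed.

(** On the simplex, f^2 lies below the affine interpolant [g] of its vertex values, and for [g] the
    vertex quadrature is exact. *)
Lemma integral_affine_sqr_le T f : nsimplex T -> affine_fun f ->
  \int[mu]_(x in hull T) (f x * f x) <=
  volume T / n.+1%:R * \sum_(x <- T) f x * f x.
Proof.
move=> sT fA; pose y i := f (vertex T i).
pose g x := \sum_(i < n.+1) y i ^+ 2 * bary T i x.
have gA : affine_fun g by apply: affine_fun_sum => i _; exact/affine_funZ/bary_affine.
have gy x : x \in T -> g x = f x * f x.
  move=> /(vertexP sT)[i ->]; rewrite /g (bigD1 i)//= bary_vertex// eqxx mulr1.
  by rewrite big1 ?addr0// => j ji; rewrite bary_vertex// (negbTE ji) mulr0.
have -> : \sum_(x <- T) f x * f x = \sum_(x <- T) g x.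
  by apply: eq_big_seq => x xT; rewrite gy.
rewrite -integral_affine//; apply: le_Rintegral.
- exact: measurable_hull.
- exact: integrable_affineM.
- exact: integrable_affine.
(* variance of the values y i under the weights bary T i x *)
move=> x hx; have [b1 _] := bary_sum x sT.
rewrite -subr_ge0 (_ : g x - _ = \sum_(i < n.+1) bary T i x * (y i - f x) ^+ 2).
  by apply: sumr_ge0 => i _; rewrite mulr_ge0 ?sqr_ge0//; have /andP[] := bary_hull i sT hx.
have fx := affine_fun_bary x sT fA.
transitivity (g x - 2 * f x * (\sum_(i < n.+1) bary T i x * y i) +
    f x ^+ 2 * \sum_(i < n.+1) bary T i x).
  by rewrite -fx b1; ring.
rewrite /g !mulr_sumr -sumrB -big_split/=; apply: eq_bigr => i _; ring.
Qed.

Lemma sum_vertices_sqr_le : exists2 C : R, 0 <= C & forall T f,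
  nsimplex T -> affine_fun f ->
  volume T / n.+1%:R * (\sum_(x <- T) f x * f x) <=
  C * \int[mu]_(x in hull T) (f x * f x).
Proof.
have half0 : 2^-1 != 0 :> R by rewrite invr_eq0.
have [K HK] := @lebesgue_rV_homothety R n 2^-1 half0.
(* Squaring f(v) = 2 f(S x) - f(x) gives f(v)^2 <= 8 f(S x)^2 + 2 f(x)^2, and the homothety [S] of
   ratio 1/2 contributes the factor [K]. The absolute value saves a proof that [K] is
   nonnegative. *)
exists (8 * `|K| + 2); first by rewrite addr_ge0// mulr_ge0.
move=> T f sT fA; have mT := measurable_hull sT.
set J := \int[mu]_(x in hull T) (f x * f x).
have J0 : 0 <= J by apply: Rintegral_ge0 => x _; rewrite -expr2 sqr_ge0.
have iff := integrable_affineM sT fA fA.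
(* f v = 2 f ((v + y) / 2) - f y for every y, so that (f v)^2 is controlled
   by the mean of f^2 over T and over its half-size copy at v. *)
have fv v : v \in T -> volume T * (f v * f v) <= (8 * `|K| + 2) * J.
  move=> vT; pose S (x : 'rV[R]_n) := 2^-1 *: x + 2^-1 *: v.
  have SE x : S x = x + 2^-1 *: (v - x).
    rewrite /S scalerBr addrCA addrC; congr (_ + _).
    rewrite -[X in X - _]scale1r -scalerBl; congr (_ *: _); lra.
  have fS x : f (S x) = 2^-1 * f x + 2^-1 * f v.
    by rewrite SE affine_funE//; lra.
  have fSA : affine_fun (f \o S).
    rewrite (_ : f \o S = fun x => 2^-1 * f x + 2^-1 * f v); last exact/funext.
    by apply: affine_funD; [exact: affine_funZ|exact: affine_fun_cst].
  have iSS := integrable_affineM sT fSA fSA.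
  have hS x : hull T x -> hull T (S x).
    rewrite hullE// => bx i; rewrite SE (affine_funE _ _ _ _ (bary_affine T i)).
    have [k ->] := vertexP sT vT; rewrite bary_vertex//.
    by have := bx i; case: (_ == _) => /=; lra.
  have JS : \int[mu]_(x in hull T) (f (S x) * f (S x)) <= `|K| * J.
    pose g := (fun x => (f x * f x)%:E) \_ (hull T).
    have mg : measurable_fun setT g.
      apply/(measurable_restrictT _ mT)/measurable_EFinP.
      by apply: (@measurable_funS _ _ _ _ setT) => //; apply: measurable_funM;
        exact: measurable_affine_fun.
    have g0 x : (0 <= g x)%E.
      by rewrite /g patchE; case: ifP => // _; rewrite lee_fin -expr2 sqr_ge0.
    have JE : J%:E = (\int[mu]_x g x)%E.
      by rewrite -integral_mkcond /J /Rintegral fineK//; exact: integrable_fin_num.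
    rewrite -lee_fin /Rintegral fineK; last exact: integrable_fin_num.
    (* [S] maps the simplex into itself, so the integrand extended by 0 lies below [g] composed with
       [S], to which the homothety formula applies on the whole space. *)
    apply: (@le_trans _ _ (\int[mu]_x g (S x))%E).
      rewrite integral_mkcond; apply: ge0_le_integral => //.
      - move=> x _; rewrite patchE; case: ifP => // _; rewrite lee_fin -expr2 sqr_ge0//.
      - apply/(measurable_restrictT _ mT)/measurable_EFinP.
        by apply: (@measurable_funS _ _ _ _ setT) => //; apply: measurable_funM;
          exact: measurable_affine_fun.
      - by apply: measurableT_comp => //; exact: measurable_affine_rV.
      - move=> x _; rewrite patchE; case: ifPn => [/set_mem/hS hx|_]; last exact: g0.
        by rewrite /g patchE mem_set.
    rewrite HK// -JE -EFinM lee_fin ler_wpM2r//; exact: ler_norm.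
  rewrite mulrC -Rintegral_cst//.
  apply: (@le_trans _ _ (\int[mu]_(x in hull T) (8 * (f (S x) * f (S x)) + 2 * (f x * f x)))).
    apply: le_Rintegral => //.
    - exact: (integrable_affine sT (affine_fun_cst _)).
    - have := integrableD mT (integrableZl mT 8 iSS) (integrableZl mT 2 iff).
      by apply: eq_integrable.
    - move=> x _; rewrite fS.
      (* The difference of the two sides is exactly this square. *)
      by have := sqr_ge0 (2 * f x + f v); rewrite expr2; lra.
  rewrite RintegralD//; last 2 first.
  - exact: (integrableZl mT 8 iSS).
  - exact: (integrableZl mT 2 iff).
  by rewrite RintegralZl// RintegralZl// -/J [leRHS]mulrDl lerD2r -mulrA ler_wpM2l.
have n1 : 0 < n.+1%:R :> R by [].
(* The bound is the same at each of the n + 1 vertices, so their number cancels the denominator of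
   the weight. *)
rewrite mulrAC ler_pdivrMr// mulr_sumr (sum_vertices (fun x => volume T * (f x * f x)) sT).
apply: (@le_trans _ _ (\sum_(i < n.+1) (8 * `|K| + 2) * J)).
  by apply: ler_sum => i _; apply: fv; exact: vertex_in.
by rewrite sumr_const card_ord mulr_natr.
Qed.

End simplex_integral.

(** * Integrals over a mesh *)

Lemma ae_all_in d (T : measurableType d) (R : realType)
    (mu : {measure set T -> \bar R}) (J : eqType) (s : seq J) (P : J -> T -> Prop) :
  (forall j, j \in s -> {ae mu, forall x, P j x}) ->
  {ae mu, forall x, forall j, j \in s -> P j x}.
Proof.
elim: s => [_|j s IH sP]; first exact: aeW.
have hj := sP j (mem_head _ _).
have {}IH := IH (fun k ks => sP k (mem_behead (s := j :: s) ks)).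
apply: filterS2 hj IH => x Pj Ps k; rewrite inE => /orP[/eqP ->//|]; exact: Ps.
Qed.

Section mesh_integral.
Context {R : realType} {n : nat}.
Implicit Types (S T : {fset 'rV[R]_n}) (Th K : {fset {fset 'rV[R]_n}}).
Local Notation mu := (@lebesgue_rV R n).

Lemma ae_bary_neq0 T i : nsimplex T -> {ae mu, forall x, bary T i x <> 0}.
Proof.
move=> sT; have b1 : bary T i (vertex T i) != 0 by rewrite bary_vertex// eqxx oner_neq0.
exists [set x | bary T i x = 0]; split.
- rewrite -[X in measurable X]setTI.
  exact: (measurable_affine_fun (bary_affine T i) measurableT (measurable_set1 0)).
- exact: affine_fun_level0 (bary_affine T i) b1.
- by move=> x /= /contrapT.
Qed.

Lemma closed_hull T : nsimplex T -> closed (hull T).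
Proof.
move=> sT; rewrite hullE//.
have -> : [set x | forall i, 0 <= bary T i x] =
    \bigcap_(i in [set: 'I_n.+1]) (bary T i @^-1` [set y | 0 <= y]).
  by apply/seteqP; split => [x h i _|x h i]; [exact: h|exact: h].
apply: closed_bigI => i _; apply: closed_comp => [x _|]; last exact: closed_ge.
exact/continuous_affine_fun/bary_affine.
Qed.

Lemma interior_hull T x : nsimplex T -> (forall i, 0 < bary T i x) -> (hull T)° x.
Proof.
move=> sT bx; rewrite /interior hullE//.
have : \forall y \near x, forall i, 0 < bary T i y.
  apply: (@filter_forall _ _ (fun i => [set y | 0 < bary T i y]) (nbhs x) (nbhs_filter x)) => i.
  have : open_nbhs x (bary T i @^-1` [set y | 0 < y]).
    split; last exact: bx.
    apply: open_comp; last exact: open_gt.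
    by move=> y _; exact/continuous_affine_fun/bary_affine.
  exact: open_nbhs_nbhs.
by apply: filterS => y h i; exact: ltW (h i).
Qed.

(** Bridges the mesh, which covers the closure, and integrals over [Om]. The finite union of closed
    simplices contains the closure of its interior [Om]; a point of it off all facet hyperplanes has
    positive barycentric coordinates in its simplex, hence is interior to the union. *)
Lemma ae_closure_polyhedral (Om : set 'rV[R]_n) : polyhedral_domain Om ->
  {ae mu, forall x, closure Om x -> Om x}.
Proof.
move=> [_ _ _ _ [K sK OmE]].
have : {ae mu, forall x, forall T, T \in enum_fset K -> forall i, i \in enum 'I_n.+1 ->
    bary T i x <> 0}.
  apply: ae_all_in => T TK; apply: ae_all_in => i _.
  by apply: ae_bary_neq0; exact: sK.
apply: filterS => x bx clx.
have cK : closed (\bigcup_(T in [set` K]) hull T).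
  by apply: closed_bigcup => [|T TK]; [exact: finite_fset|exact/closed_hull/sK].
have [T TK hx] : (\bigcup_(T in [set` K]) hull T) x.
  apply: cK; apply: closure_subset clx; rewrite OmE; exact: interior_subset.
rewrite OmE; apply: (@interiorS _ (hull T)); first by move=> y hy; exists T.
apply: interior_hull; first exact: sK.
move=> i; rewrite lt_def; have := hx; rewrite hullE; last exact: sK.
move=> /(_ i) ->; rewrite andbT; apply/eqP; apply: bx => //.
by rewrite mem_enum.
Qed.

(** Having equally many vertices, distinct simplices cannot be nested, so some vertex of [S] is
    missing from [T]. By conformity the overlap is spanned by common vertices and lies in the null
    hyperplane opposite to the missing one. *)
Lemma ae_hull_disjoint (Om : set 'rV[R]_n) Th S T : simplicial_mesh Om Th ->
  S \in Th -> T \in Th -> S != T -> {ae mu, forall x, hull S x -> hull T x -> False}.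
Proof.
move=> [sTh _ mTh] STh TTh ST; have sS := sTh _ STh; have sT := sTh _ TTh.
have [v vS vT] : exists2 v, v \in S & v \notin T.
  apply/fsubsetPn; apply: contra ST => ST; rewrite eqEfcard ST/=.
  by rewrite (proj1 sS) (proj1 sT).
have [i vE] := vertexP sS vS.
apply: filterS (ae_bary_neq0 i sS) => x bx hS hT; apply: bx.
have : hull (S `&` T)%fset x by rewrite -mTh.
apply: hull_sub_bary0 => //; first exact: fsubsetIl.
by rewrite -vE in_fsetI (negbTE vT) andbF.
Qed.

(** Almost every point of [Om] lies in exactly one simplex and almost every point outside in none.
    The pieces [G T] are separate from [F] because a form equals its polynomial on a simplex only
    almost everywhere. *)
Lemma integral_mesh (Om : set 'rV[R]_n) Th (F : 'rV[R]_n -> R)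
    (G : {fset 'rV[R]_n} -> 'rV[R]_n -> R) :
  polyhedral_domain Om -> simplicial_mesh Om Th ->
  measurable_fun Om F ->
  (forall T, T \in Th -> mu.-integrable (hull T) (EFin \o G T)) ->
  (forall T, T \in Th -> {ae mu, forall x, hull T x -> F x = G T x}) ->
  \int[mu]_(x in Om) F x = \sum_(T <- Th) \int[mu]_(x in hull T) G T x.
Proof.
move=> pOm mTh mF iG FG; have [_ oOm _ _ _] := pOm; have [sTh clOm _] := mTh.
have mOm := measurable_open_rV oOm.
pose H x := \sum_(T <- Th) (G T \_ (hull T)) x.
have iGr T : T \in Th -> mu.-integrable setT (EFin \o (G T \_ (hull T))).
  move=> TTh; have /(integrable_mkcond _ (measurable_hull (sTh _ TTh))) := iG T TTh.
  by apply: eq_integrable => // x _; rewrite /= !patchE; case: ifP.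
rewrite Rintegral_mkcond; transitivity (\int[mu]_x H x); last first.
  rewrite Rintegral_sum//; apply: eq_big_seq => T TTh.
  by rewrite -Rintegral_mkcond.
congr fine; apply: ae_eq_integral => //.
- apply/measurable_EFinP; exact/(measurable_restrictT _ mOm).
- exact: measurable_int (integrable_EFin_sum measurableT iGr).
have hD : {ae mu, forall x, forall S, S \in enum_fset Th -> forall T, T \in enum_fset Th ->
    S != T -> hull S x -> hull T x -> False}.
  apply: ae_all_in => S STh; apply: ae_all_in => T TTh.
  have [->|ST] := eqVneq S T; first by apply: aeW => x /eqP.
  by apply: filterS (ae_hull_disjoint mTh STh TTh ST) => x h _.
have hF : {ae mu, forall x, forall T, T \in enum_fset Th -> hull T x -> F x = G T x}.
  exact: ae_all_in.
apply: filterS3 (ae_closure_polyhedral pOm) hD hF => x hcl hD hF _ /=; congr EFin.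
rewrite patchE /H; case: ifPn => [/set_mem Omx|/negP Omx].
  have [T TTh hT] : (\bigcup_(T in [set` Th]) hull T) x.
    by rewrite -clOm; exact: subset_closure.
  rewrite (big_fsetD1 T TTh)/= patchE mem_set// -(hF _ TTh hT) big_seq big1 ?addr0//.
  move=> S; rewrite in_fsetD1 => /andP[ST STh]; rewrite patchE.
  by case: ifPn => // /set_mem hS; case: (hD _ STh _ TTh ST).
rewrite big_seq big1// => T TTh; rewrite patchE; case: ifPn => // /set_mem hT.
case: Omx; apply/mem_set/hcl; rewrite clOm; by exists T.
Qed.

End mesh_integral.

(** * Piecewise linear forms *)

Section alt_theory.
Context {R : realType} {n j : nat}.
Implicit Types (a b c : alt R n j) (v : 'I_j -> 'rV[R]_n).

Lemma alt_sum (I : Type) (r : seq I) (P : pred I) (F : I -> alt R n j) v :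
  (\sum_(i <- r | P i) F i) v = \sum_(i <- r | P i) F i v :> R.
Proof. by elim/big_rec2: _ => // i x y _ <-. Qed.

Lemma alt_ext a b : (forall v, a v = b v) -> a = b.
Proof. by move=> ab; apply/val_inj/funext. Qed.

Lemma alt_dotC a b : alt_dot a b = alt_dot b a.
Proof. by apply: eq_bigr => s _; rewrite mulrC. Qed.

Lemma alt_dot_linear (k : R) a b c :
  alt_dot (k *: a + b) c = k * alt_dot a c + alt_dot b c.
Proof.
rewrite /alt_dot mulr_sumr -big_split/=; apply: eq_bigr => s _.
by rewrite mulrA -mulrDl.
Qed.

Lemma alt_dot_ge0 a : 0 <= alt_dot a a.
Proof. by apply: sumr_ge0 => s _; rewrite -expr2 sqr_ge0. Qed.

End alt_theory.

Section piecewise_linear.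
Context {R : realType} {n j : nat}.
Implicit Types (T : {fset 'rV[R]_n}) (Th : {fset {fset 'rV[R]_n}}) (p q u v : dform R n j).
Local Notation mu := (@lebesgue_rV R n).

Lemma affine_fun_monomial (m : {ffun 'I_n -> 'I_2}) : (\sum_i m i <= 1)%N ->
  affine_fun (fun x : 'rV[R]_n => \prod_i x 0 i ^+ m i).
Proof.
move=> m1; have [/existsP[i mi]|/existsPn m0] := boolP [exists i, (0 < m i)%N].
  have mi1 : m i = 1%N :> nat by apply/eqP; rewrite eqn_leq mi andbT -ltnS ltn_ord.
  move: m1; rewrite (bigD1 i)//= mi1 -[leqRHS]addn0 leq_add2l leqn0 sum_nat_eq0.
  move=> /forallP m0; rewrite (_ : (fun x => _) = (fun x : 'rV[R]_n => x 0 i)).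
    exact: affine_fun_coord.
  apply/funext => x; rewrite (bigD1 i)//= mi1 expr1 big1 ?mulr1// => k ki.
  by have := m0 k; rewrite ki/= => /eqP ->; rewrite expr0.
rewrite (_ : (fun x => _) = (fun=> 1)); first exact: affine_fun_cst.
apply/funext => x; rewrite big1// => i _.
by have := m0 i; rewrite -eqn0Ngt => /eqP ->; rewrite expr0.
Qed.

Lemma poly_form1_affine p w : poly_form 1 j p -> affine_fun (fun x => p x w : R).
Proof.
move=> [c pE]; have -> : (fun x => p x w : R) = (fun x =>
    \sum_(m : {ffun 'I_n -> 'I_2} | (\sum_i m i <= 1)%N) (c m w : R) * \prod_i x 0 i ^+ m i).
  by apply/funext => x; rewrite pE alt_sum; apply: eq_bigr => m _; rewrite mulrC.
by apply: affine_fun_sum => m m1; apply/affine_funZ/affine_fun_monomial.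
Qed.

Lemma poly_form_linear r (k : R) p q : poly_form r j p -> poly_form r j q ->
  poly_form r j (k *: p + q).
Proof.
move=> [c pE] [d qE]; exists [ffun m => k *: c m + d m] => x.
rewrite -[LHS]/(k *: p x + q x) pE qE scaler_sumr -big_split/=.
by apply: eq_bigr => m _; rewrite ffunE scalerDr !scalerA mulrC.
Qed.

Lemma poly_form_cst r (a : alt R n j) : poly_form r j (fun=> a).
Proof.
exists [ffun m => if m == [ffun=> ord0] then a else 0] => x.
rewrite (bigD1 [ffun=> ord0])/=; last by rewrite big1// => i _; rewrite ffunE.
rewrite ffunE eqxx [X in X *: _]big1 ?scale1r; last by move=> i _; rewrite ffunE.
rewrite big1 ?addr0// => m /andP[_ /negbTE m0].
by rewrite ffunE m0 scaler0.
Qed.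

Lemma poly_form0 p : poly_form 0 j p -> exists a : alt R n j, p = fun=> a.
Proof.
move=> [c pE]; exists (\sum_(m : {ffun 'I_n -> 'I_1} | (\sum_i m i <= 0)%N) c m).
apply/funext => x; rewrite pE; apply: eq_bigr => m _.
by rewrite big1 ?scale1r// => i _; rewrite (ord1 (m i)).
Qed.

(** If some component of p - q were nonzero at one point, it would be an affine function with a null
    zero set; but that set contains almost all of the simplex. *)
Lemma poly_form1_unique T p q : nsimplex T -> volume T != 0 ->
  poly_form 1 j p -> poly_form 1 j q -> ae_eq_form (hull T) p q -> p = q.
Proof.
move=> sT v0 pP qP pq; apply/funext => x; apply/alt_ext => w; apply: contrapT => pqx.
pose f x := (p x w : R) + -1 * (q x w : R).
have fA : affine_fun f by apply: affine_funD; [|apply: affine_funZ]; exact: poly_form1_affine.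
have fx : f x != 0.
  by apply/eqP => fx; apply: pqx; apply/eqP; rewrite -subr_eq0 -fx /f mulN1r.
have := affine_fun_level0 fA fx => f0.
have mf : measurable [set x | f x = 0].
  rewrite -[X in measurable X]setTI.
  exact: (measurable_affine_fun fA measurableT (measurable_set1 0)).
have : mu.-negligible (hull T).
  apply: (@negligibleS _ _ _ _ ([set x | f x = 0] `|` ~` [set x | hull T x -> p x = q x])).
    move=> y hy; have [h|h] := pselect (hull T y -> p y = q y); [left|by right].
    by rewrite /= /f h// mulN1r subrr.
  by apply: negligibleU; [exact/negligibleP|exact: pq].
move=> /(negligibleP _ (measurable_hull sT)).
by move=> /(etrans (volumeE sT))[v00]; move: v0; rewrite v00 eqxx.
Qed.

Lemma restrP T u p : poly_form 1 j p -> ae_eq_form (hull T) u p ->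
  poly_form 1 j (restr T u) /\ ae_eq_form (hull T) u (restr T u).
Proof.
move=> pP up; exact: (@xgetPex _ 0
  [set p | poly_form 1 j p /\ ae_eq_form (hull T) u p] (ex_intro _ p (conj pP up))).
Qed.

Lemma restr_eq T u p : nsimplex T -> volume T != 0 ->
  poly_form 1 j p -> ae_eq_form (hull T) u p -> restr T u = p.
Proof.
move=> sT v0 pP up; have [rP ur] := restrP pP up.
apply: (poly_form1_unique sT) => //.
by apply: filterS2 ur up => x h1 h2 hx; rewrite -h1// h2.
Qed.

Lemma restr_linear T (k : R) u v : nsimplex T -> volume T != 0 ->
  (exists2 p, poly_form 1 j p & ae_eq_form (hull T) u p) ->
  (exists2 p, poly_form 1 j p & ae_eq_form (hull T) v p) ->
  restr T (k *: u + v) = k *: restr T u + restr T v.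
Proof.
move=> sT v0 [p pP up] [q qP vq]; rewrite (restr_eq sT v0 pP up) (restr_eq sT v0 qP vq).
apply: restr_eq => //; first exact: poly_form_linear.
apply: filterS2 up vq => x h1 h2 hx.
by rewrite -[LHS]/(k *: u x + v x) h1// h2.
Qed.

Lemma piecewise_linear_closed r Th (k : R) u v :
  piecewise (poly_form r j) Th u -> piecewise (poly_form r j) Th v ->
  piecewise (poly_form r j) Th (k *: u + v).
Proof.
move=> uP vP T TTh; have [p pP up] := uP T TTh; have [q qP vq] := vP T TTh.
exists (k *: p + q); first exact: poly_form_linear.
apply: filterS2 up vq => x h1 h2 hx.
by rewrite -[LHS]/(k *: u x + v x) h1// h2.
Qed.

Lemma form_dot_h_linear Th (k : R) u v w : (forall T, T \in Th -> nsimplex T) ->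
  piecewise (poly_form 1 j) Th u -> piecewise (poly_form 1 j) Th v ->
  form_dot_h Th (k *: u + v) w = k * form_dot_h Th u w + form_dot_h Th v w.
Proof.
move=> sTh uP vP; rewrite /form_dot_h mulr_sumr -big_split/=.
apply: eq_big_seq => T TTh; have sT := sTh T TTh.
(* Uniqueness of the representative is available only for nonzero volume; otherwise the weight of
   the term is 0. *)
have [v0|v0] := eqVneq (volume T) 0; first by rewrite v0 !mul0r mulr0 addr0.
rewrite restr_linear//; [|exact: uP|exact: vP].
rewrite mulrCA -mulrDr; congr (_ * _).
rewrite mulr_sumr -big_split/=; apply: eq_bigr => x _.
exact: alt_dot_linear.
Qed.

Lemma form_dot_hC Th u v : form_dot_h Th u v = form_dot_h Th v u.
Proof.
apply: eq_bigr => T _; congr (_ * _); apply: eq_bigr => x _; exact: alt_dotC.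
Qed.

Lemma form_dot_h_ge0 Th u : 0 <= form_dot_h Th u u.
Proof.
apply: sumr_ge0 => T _; rewrite mulr_ge0// ?divr_ge0// ?volume_ge0//.
by apply: sumr_ge0 => x _; exact: alt_dot_ge0.
Qed.

End piecewise_linear.

(** * Mass lumping *)

(** For A > 0 the quadratic is evaluated at its minimiser -B / A. The case A = 0 is included because
    the lumped form vanishes on the zero form. *)
Lemma quadratic_ge0_discr (R : realFieldType) (A B D : R) : 0 <= A ->
  (forall l, 0 <= l ^+ 2 * A + 2 * l * B + D) -> B ^+ 2 <= A * D.
Proof.
move=> A0 h; have [A0'|An0] := eqVneq A 0.
  have [->|B0] := eqVneq B 0; first by rewrite expr0n/= A0' mul0r.
  (* With A = 0 and B nonzero the polynomial is linear, and it takes the value -1 at this point. *)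
  have := h (- (D + 1) / (2 * B)); rewrite A0' mulr0 add0r.
  have -> : 2 * (- (D + 1) / (2 * B)) * B = - (D + 1) by field; rewrite B0.
  by move=> ?; lra.
have Agt0 : 0 < A by rewrite lt_def An0.
have := h (- B / A).
have -> : (- B / A) ^+ 2 * A + 2 * (- B / A) * B + D = (A * D - B ^+ 2) / A by field.
by rewrite pmulr_lge0 ?invr_gt0// subr_ge0.
Qed.

Section mass_lumping.
Context {R : realType} {n j : nat} {Om : set 'rV[R]_n} {Th : {fset {fset 'rV[R]_n}}}.
Hypotheses (pOm : polyhedral_domain Om) (mTh : simplicial_mesh Om Th).
Implicit Types (T : {fset 'rV[R]_n}) (u v : dform R n j).
Local Notation mu := (@lebesgue_rV R n).

Let sTh T : T \in Th -> nsimplex T. Proof. by have [+ _ _] := mTh; apply. Qed.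

(** The increasing multi-indices as an explicit sequence, the shape in which sums are exchanged with
    integrals. *)
Let incr : seq {ffun 'I_j -> 'I_n} :=
  [seq s : {ffun 'I_j -> 'I_n} <- index_enum _ | [forall i : 'I_j, forall k : 'I_j, (i < k)%N ==> (s i < s k)%N]].

Let e (s : {ffun 'I_j -> 'I_n}) : 'I_j -> 'rV[R]_n := alt_basis_vec R s.

Lemma alt_dotE (a b : alt R n j) : alt_dot a b = \sum_(s <- incr) a (e s) * b (e s).
Proof. by rewrite /alt_dot -big_filter. Qed.

Let V1 u := (forall w, measurable_fun Om (fun x => u x w : R)) /\
  piecewise (poly_form 1 j) Th u.

Lemma measurable_alt_dot u v :
  (forall w, measurable_fun Om (fun x => u x w : R)) ->
  (forall w, measurable_fun Om (fun x => v x w : R)) ->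
  measurable_fun Om (fun x => alt_dot (u x) (v x)).
Proof.
move=> mu' mv; under eq_fun do rewrite alt_dotE.
by apply: measurable_sum => s; exact: measurable_funM.
Qed.

Lemma integrable_alt_dot T (p q : dform R n j) : nsimplex T ->
  poly_form 1 j p -> poly_form 1 j q ->
  mu.-integrable (hull T) (EFin \o (fun x => alt_dot (p x) (q x))).
Proof.
move=> sT pP qP; rewrite (funext (fun x => alt_dotE (p x) (q x))).
apply: integrable_EFin_sum => [|s _]; first exact: measurable_hull.
by apply: integrable_affineM => //; exact: poly_form1_affine.
Qed.

(** The pieces [q T] of [v] are left free so that one statement serves a piecewise constant [v],
    given by its constants, and the case v = u, given by [restr]. *)
Lemma form_dot_mesh u v (q : {fset 'rV[R]_n} -> dform R n j) : V1 u ->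
  (forall w, measurable_fun Om (fun x => v x w : R)) ->
  (forall T, T \in Th -> poly_form 1 j (q T) /\ ae_eq_form (hull T) v (q T)) ->
  form_dot Om u v =
  \sum_(T <- Th) \int[mu]_(x in hull T) alt_dot (restr T u x) (q T x).
Proof.
move=> [mu' uP] mv qP; apply: integral_mesh => //; first exact: measurable_alt_dot.
  move=> T TTh; have [p pP up] := uP T TTh.
  by apply: integrable_alt_dot; [exact: sTh|exact: (restrP pP up).1|exact: (qP T TTh).1].
move=> T TTh; have [p pP up] := uP T TTh.
apply: filterS2 (restrP pP up).2 (qP T TTh).2 => x h1 h2 hx.
by rewrite h1// h2.
Qed.

Lemma form_dot_quadrature u v : V1 u ->
  (forall w, measurable_fun Om (fun x => v x w : R)) ->
  piecewise (poly_form 0 j) Th v -> form_dot Om u v = form_dot_h Th u v.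
Proof.
move=> uV mv vP.
have /choice[a aP] : forall T, exists a : alt R n j, T \in Th -> ae_eq_form (hull T) v (fun=> a).
  move=> T; have [TTh|_] := boolP (T \in Th); last by exists 0.
  by have [p /poly_form0[a ->] vp] := vP T TTh; exists a.
rewrite (form_dot_mesh (q := fun T => fun=> a T) uV mv); last first.
  by move=> T TTh; split; [exact: poly_form_cst|exact: aP].
apply: eq_big_seq => T TTh; have sT := sTh TTh.
have [p pP up] := uV.2 T TTh; have [rP _] := restrP pP up.
rewrite integral_affine//; last first.
  rewrite (funext (fun x => alt_dotE (restr T u x) (a T))).
  apply: affine_fun_sum => s _; under eq_fun do rewrite mulrC.
  exact/affine_funZ/poly_form1_affine.
(* For nonzero volume, [restr] must recover the constant form by uniqueness; on a null simplex both
   terms are 0. *)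
have [v0|v0] := eqVneq (volume T) 0; first by rewrite v0 !mul0r.
by rewrite (restr_eq (u := v) sT v0 (poly_form_cst 1 (a T)) (aP T TTh)).
Qed.

(** Brings the exact norm to the same double sum as the lumped one, so that the two are compared
    term by term through scalar affine functions. *)
Lemma form_dot_cell u : V1 u -> form_dot Om u u = \sum_(T <- Th) \sum_(s <- incr)
  \int[mu]_(x in hull T) ((restr T u x (e s) : R) * restr T u x (e s)).
Proof.
move=> uV; rewrite (form_dot_mesh (q := fun T => restr T u) uV uV.1); last first.
  by move=> T TTh; have [p pP up] := uV.2 T TTh; exact: restrP up.
apply: eq_big_seq => T TTh; have [p pP up] := uV.2 T TTh; have [rP _] := restrP pP up.
have mT := measurable_hull (sTh TTh).
rewrite -Rintegral_sum//; first by apply: eq_Rintegral => x _; rewrite alt_dotE.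
by move=> s _; apply: integrable_affineM; [exact: sTh|exact: poly_form1_affine..].
Qed.

Lemma form_dot_h_cell u : form_dot_h Th u u = \sum_(T <- Th) \sum_(s <- incr)
  volume T / n.+1%:R * \sum_(x <- T) (restr T u x (e s) : R) * restr T u x (e s).
Proof.
apply: eq_bigr => T _; rewrite -[RHS]mulr_sumr; congr (_ * _); rewrite [RHS]exchange_big/=.
by apply: eq_bigr => x _; rewrite alt_dotE.
Qed.

Lemma form_dot_le_h u : V1 u -> form_dot Om u u <= form_dot_h Th u u.
Proof.
move=> uV; rewrite form_dot_cell// form_dot_h_cell big_seq [leRHS]big_seq.
apply: ler_sum => T TTh; have [p pP up] := uV.2 T TTh; have [rP _] := restrP pP up.
apply: ler_sum => s _; apply: integral_affine_sqr_le; first exact: sTh.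
exact: poly_form1_affine.
Qed.

Lemma form_dot_h_le (C : R) u : (forall T (f : 'rV[R]_n -> R),
    nsimplex T -> affine_fun f ->
    volume T / n.+1%:R * (\sum_(x <- T) f x * f x) <=
    C * \int[mu]_(x in hull T) (f x * f x)) ->
  V1 u -> form_dot_h Th u u <= C * form_dot Om u u.
Proof.
move=> hC uV; rewrite form_dot_cell// form_dot_h_cell mulr_sumr big_seq [leRHS]big_seq.
apply: ler_sum => T TTh; have [p pP up] := uV.2 T TTh; have [rP _] := restrP pP up.
rewrite mulr_sumr; apply: ler_sum => s _.
by apply: hC; [exact: sTh|exact: poly_form1_affine].
Qed.

Lemma form_dot_ge0 u : 0 <= form_dot Om u u.
Proof. by apply: Rintegral_ge0 => x _; exact: alt_dot_ge0. Qed.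

(** Cauchy-Schwarz, from nonnegativity of the lumped form on l u + v for all l. *)
Lemma form_dot_h_sqr_le u v :
  piecewise (poly_form 1 j) Th u -> piecewise (poly_form 1 j) Th v ->
  form_dot_h Th u v ^+ 2 <= form_dot_h Th u u * form_dot_h Th v v.
Proof.
move=> uP vP; apply: quadratic_ge0_discr => [|l]; first exact: form_dot_h_ge0.
apply: le_trans (form_dot_h_ge0 Th (l *: u + v)) _.
rewrite form_dot_h_linear// (form_dot_hC _ u) (form_dot_hC _ v).
rewrite !form_dot_h_linear// (form_dot_hC _ v u) le_eqVlt; apply/orP; left; apply/eqP; ring.
Qed.

End mass_lumping.

(** * The spaces of forms are linear *)

Section alt_expansion.
Context {R : realType} {n j : nat}.
Implicit Types (a : alt R n j) (v : 'I_j -> 'rV[R]_n).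

Lemma alt_dfwithD a v i x y :
  a (dfwith v i (x + y)) = (a (dfwith v i x) : R) + (a (dfwith v i y) : R).
Proof.
have := alt_funP a; rewrite inE => -[aM _].
by rewrite -[X in X + _]scale1r aM mul1r.
Qed.

Lemma alt_dfwith0 a v i : a (dfwith v i 0) = 0.
Proof.
have := alt_dfwithD a v i 0 0; rewrite addr0 => /eqP.
by rewrite -subr_eq0 opprD addrA subrr sub0r oppr_eq0 => /eqP.
Qed.

Lemma alt_dfwithZ a v i c x : a (dfwith v i (c *: x)) = c * (a (dfwith v i x) : R).
Proof.
have := alt_funP a; rewrite inE => -[aM _].
by rewrite -[c *: x]addr0 aM [X in _ + X]alt_dfwith0 addr0.
Qed.

Lemma alt_dfwith_sum a v i (J : Type) (r : seq J) (F : J -> 'rV[R]_n) :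
  a (dfwith v i (\sum_(l <- r) F l)) = \sum_(l <- r) (a (dfwith v i (F l)) : R).
Proof.
elim: r => [|l r IH]; first by rewrite !big_nil alt_dfwith0.
by rewrite !big_cons alt_dfwithD IH.
Qed.

Lemma dfwith_id v i : dfwith v i (v i) = v.
Proof.
apply/funext => k; have [<-|ik] := eqVneq i k; first by rewrite dfwithin.
by rewrite dfwithout.
Qed.

(** Polarisation: [a] vanishes when [v i + v k] is put in both slots, and expanding leaves only the
    two mixed terms. [W x y] is [v] with [x] in slot [i] and [y] in slot [k]. *)
Lemma alt_tperm a v i k : i != k -> a (v \o tperm i k) = - (a v : R).
Proof.
move=> ik; have := alt_funP a; rewrite inE => -[_ aA].
pose W x y := dfwith (dfwith v i x) k y.
have W0 x : a (W x x) = 0.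
  by apply: (aA _ i k) => //; rewrite /W dfwithin dfwithout ?dfwithin// eq_sym.
have WE x y : W x y = dfwith (dfwith v k y) i x.
  apply/funext => l; rewrite /W; have [<-|kl] := eqVneq k l.
    by rewrite dfwithin dfwithout// dfwithin.
  rewrite [LHS]dfwithout//; have [<-|il] := eqVneq i l; first by rewrite !dfwithin.
  by rewrite !dfwithout.
have Wv : W (v i) (v k) = v.
  by rewrite /W !dfwith_id.
have Wt : W (v k) (v i) = v \o tperm i k.
  apply/funext => l; rewrite /W /=; case: tpermP => [->|->|/eqP li /eqP lk].
  - by rewrite [LHS]dfwithout 1?eq_sym// dfwithin.
  - by rewrite dfwithin.
  - by rewrite [LHS]dfwithout 1?eq_sym// dfwithout 1?eq_sym.
have := W0 (v i + v k); rewrite {1}/W alt_dfwithD -!/(W _ _) !WE !alt_dfwithD -!WE !W0.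
rewrite Wv Wt add0r addr0 => h; apply/eqP; rewrite -addr_eq0; apply/eqP.
exact: h.
Qed.

(** Here [c] is the sign of [p], built up along a product of transpositions; what matters is that
    one scalar serves all [a] and [v]. *)
Lemma alt_perm (p : {perm 'I_j}) : exists c : R, forall a v, a (v \o p) = c * (a v : R).
Proof.
have [ts -> _] := prod_tpermP p; elim: ts => [|[i k] ts [c IH]].
  exists 1 => a v; rewrite big_nil mul1r; congr (a _).
  by apply/funext => l; rewrite /= perm1.
have [ik|ik] := eqVneq i k.
  exists c => a v; rewrite -IH big_cons/= ik; congr (a _).
  by apply/funext => l; rewrite /= permM tperm1 perm1.
exists (- c) => a v; rewrite mulNr -IH -(alt_tperm a _ ik) big_cons; congr (a _).
by apply/funext => l; rewrite /= permM.
Qed.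

Lemma increasing_rearrangement (s : 'I_j -> 'I_n) : injective s ->
  exists (t : {ffun 'I_j -> 'I_n}) (p : {perm 'I_j}),
    (forall i k : 'I_j, (i < k)%N -> (t i < t k)%N) /\ (forall i, s i = t (p i)).
Proof.
move=> sI; pose S := [tuple s i | i < j]; pose L := sort_tuple <=%O S.
have /tuple_permP[p SE] : perm_eq S L by rewrite perm_sym perm_sort.
exists [ffun i => tnth L i], p; split=> [i k ik|i]; last first.
  rewrite ffunE; have := congr1 (fun l => nth (s i) l i) SE.
  by rewrite -!tnth_nth !tnth_mktuple.
have Lu : sorted <%O L.
  rewrite lt_sorted_uniq_le sort_le_sorted andbT sort_uniq.
  by rewrite map_inj_uniq ?enum_uniq.
rewrite !ffunE !(tnth_nth (s i)).
have : (nth (s i) L i < nth (s i) L k)%O by rewrite lt_sorted_ltn_nth// inE size_tuple.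
by rewrite ltEord.
Qed.

Let increasing (s : {ffun 'I_j -> 'I_n}) :=
  [forall i : 'I_j, forall k : 'I_j, (i < k)%N ==> (s i < s k)%N].

(* Makes every component of an L^2 form integrable, although only the
   increasing ones enter its norm. *)
Lemma alt_expansion v : exists c : {ffun 'I_j -> 'I_n} -> R, forall a,
  a v = \sum_(s | increasing s) c s * (a (alt_basis_vec R s) : R).
Proof.
(* Induction on the number of slots not yet known to hold basis vectors: m = j imposes nothing, and
   at m = 0 all slots hold basis vectors, so either an index repeats and [a] vanishes or the indices
   can be sorted. *)
suff H m : forall v, (forall i : 'I_j, (m <= i)%N -> exists l, v i = delta_mx 0 l) ->
    exists c : {ffun 'I_j -> 'I_n} -> R, forall a,
    a v = \sum_(s | increasing s) c s * (a (alt_basis_vec R s) : R).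
  by apply: (H j) => i; rewrite leqNgt ltn_ord.
elim: m => [|m IH] {}v vm.
  have /choice[s sE] : forall i, exists l, v i = delta_mx 0 l by move=> i; exact: vm.
  have vE : v = alt_basis_vec R s by exact/funext.
  have [sI|sNI] := pselect (injective s); last first.
    exists (fun=> 0) => a; rewrite big1; last by move=> t _; rewrite mul0r.
    have [i [k [ik sik]]] : exists i k, i != k /\ s i = s k.
      apply: contrapT => h; apply: sNI => i k sik; apply/eqP/negPn/negP => ik.
      by apply: h; exists i, k.
    have := alt_funP a; rewrite inE => -[_ aA].
    by apply: (aA _ i k) => //; rewrite !sE sik.
  have [t [p [tI sE']]] := increasing_rearrangement sI.
  have [c cE] := alt_perm p.
  exists (fun s => if s == t then c else 0) => a.
  rewrite (bigD1 t)/=; last by apply/forallP => i; apply/forallP => k; apply/implyP; exact: tI.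
  rewrite eqxx big1 ?addr0; last by move=> q /andP[_ /negbTE ->]; rewrite mul0r.
  by rewrite -cE vE; congr (a _); apply/funext => i; rewrite /alt_basis_vec sE'.
have [mj|jm] := ltnP m j; last first.
  by apply: IH => i mi; have := ltn_ord i; rewrite ltnNge (leq_trans jm mi).
pose i0 := Ordinal mj.
have /choice[c cE] : forall l : 'I_n, exists c : {ffun 'I_j -> 'I_n} -> R, forall a,
    a (dfwith v i0 (delta_mx 0 l)) =
    \sum_(s | increasing s) c s * (a (alt_basis_vec R s) : R).
  move=> l; apply: IH => i mi; have [<-|ii0] := eqVneq i0 i.
    by exists l; rewrite dfwithin.
  rewrite dfwithout//; apply: vm; rewrite ltn_neqAle mi andbT.
  by apply: contra ii0 => /eqP mi'; apply/eqP/val_inj.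
exists (fun s => \sum_l v i0 0 l * c l s) => a.
transitivity (a (dfwith v i0 (\sum_(l < n) v i0 0 l *: delta_mx 0 l)) : R).
  by rewrite -row_sum_delta dfwith_id.
rewrite alt_dfwith_sum.
under eq_bigr do rewrite alt_dfwithZ cE mulr_sumr.
rewrite exchange_big/=; apply: eq_bigr => s _.
by rewrite mulr_suml; apply: eq_bigr => l _; rewrite mulrA.
Qed.

End alt_expansion.

(** * Closure of the form spaces under linear combinations *)

Section HLambda_submodule.
Context {R : realType} {n : nat} {Om : set 'rV[R]_n}.
Hypotheses (oOm : open Om) (bOm : bounded_set Om).
Local Notation mu := (@lebesgue_rV R n).

Let mOm : measurable Om := measurable_open_rV oOm.

Let Om_lty : (mu Om < +oo)%E.
Proof. by have [C hC] := bounded_set_rV_coord bOm; exact: lebesgue_rV_bounded mOm hC. Qed.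

(** A bounded set lies in a product of segments, which is compact. *)
Lemma continuous_bounded_on (f : 'rV[R]_n -> R) : continuous f ->
  [bounded f x | x in Om].
Proof.
move=> cf; have [C hC] := bounded_set_rV_coord bOm.
have /compact_bounded[M [Mr hM]] :
    compact [set f x | x in [set x : 'rV[R]_n | forall i, `[- C, C]%classic (x ord0 i)]].
  apply: continuous_compact; first exact: continuous_subspaceT.
  apply: (@rV_compact R n (fun=> `[- C, C]%classic)) => i; exact: segment_compact.
exists M; split => // N MN x Omx; apply: hM => //; exists x => // i.
by rewrite /= in_itv/= -ler_norml; exact: hC.
Qed.

Lemma alt_dot_linear_le j (k : R) (a b : alt R n j) :
  alt_dot (k *: a + b) (k *: a + b) <= 2 * k ^+ 2 * alt_dot a a + 2 * alt_dot b b.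
Proof.
rewrite /alt_dot !mulr_sumr -big_split/=; apply: ler_sum => s _.
rewrite -[X in X * X]/(k * (a _ : R) + (b _ : R)).
set x := a _ : R; set y := b _ : R.
have := sqr_ge0 (k * x - y); rewrite expr2; nra.
Qed.

Lemma L2_form_integrable_sqr j (u : dform R n j) : L2_form Om u ->
  mu.-integrable Om (EFin \o (fun x => alt_dot (u x) (u x))).
Proof.
move=> [mu' uoo]; apply/integrableP; split.
  by apply/measurable_EFinP; apply: measurable_alt_dot.
under eq_integral do rewrite /= ger0_norm ?alt_dot_ge0//.
exact: uoo.
Qed.

Lemma L2_form_linear j (k : R) (u v : dform R n j) :
  L2_form Om u -> L2_form Om v -> L2_form Om (k *: u + v).
Proof.
move=> uL vL; have mw w : measurable_fun Om (fun x => (k *: u + v) x w : R).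
  apply: (@measurable_funD _ _ _ _ (fun x => k * (u x w : R)) (fun x => v x w : R)).
    by apply: measurable_funM => //; exact: uL.1.
  exact: vL.1.
split=> //.
have iuv := integrableD mOm (integrableZl mOm (2 * k ^+ 2) (L2_form_integrable_sqr uL))
  (integrableZl mOm 2 (L2_form_integrable_sqr vL)).
apply: le_lt_trans (integrable_lty mOm iuv); apply: ge0_le_integral => //.
- by move=> x _; rewrite lee_fin alt_dot_ge0.
- by apply/measurable_EFinP; apply: measurable_alt_dot.
- exact: measurable_int iuv.
- by move=> x _; rewrite lee_fin; exact: alt_dot_linear_le.
Qed.

(** Makes the integrals of the weak derivative additive. On the bounded domain |y| <= 1 + y^2 makes
    each increasing component integrable, the expansion carries this to an arbitrary [w], and the
    continuous [f] is bounded there. *)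
Lemma L2_form_integrable j (u : dform R n j) w (f : 'rV[R]_n -> R) :
  L2_form Om u -> continuous f ->
  mu.-integrable Om (EFin \o (fun x => (u x w : R) * f x)).
Proof.
move=> uL cf; suff iu : mu.-integrable Om (EFin \o (fun x => u x w : R)).
  have mf : measurable_fun Om f.
    by apply: (@measurable_funS _ _ _ _ setT) => //; exact: continuous_measurable_rV.
  have := integrableMl mOm iu mf (continuous_bounded_on cf).
  by apply: eq_integrable.
have [c cE] := @alt_expansion R n j w.
have -> : (fun x => u x w : R) = (fun x => \sum_(s <- [seq s : {ffun 'I_j -> 'I_n} <- index_enum _ |
    [forall i : 'I_j, forall k : 'I_j, (i < k)%N ==> (s i < s k)%N]])
    c s * (u x (alt_basis_vec R s) : R)).
  by apply/funext => x; rewrite cE big_filter.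
apply: integrable_EFin_sum => // s; rewrite mem_filter => /andP[sI _].
suff us : mu.-integrable Om (EFin \o (fun x => u x (alt_basis_vec R s) : R)).
  exact: (integrableZl mOm (c s) us).
have i1 : mu.-integrable Om (EFin \o (fun=> 1 : R)).
  apply: measurable_bounded_integrable => //.
  by exists 1; split => // N N1 x _; rewrite normr1 ltW.
apply: le_integrable (integrableD mOm i1 (L2_form_integrable_sqr uL)) => //.
  by apply/measurable_EFinP; exact: uL.1.
move=> x _ /=; rewrite lee_fin [leRHS]ger0_norm ?addr_ge0 ?alt_dot_ge0//.
set y := u x _ : R; apply: (@le_trans _ _ (1 + y * y)).
  by rewrite -[y * y]real_normK ?num_real//; have := sqr_ge0 (`|y| - 1); nra.
rewrite lerD2l /alt_dot (bigD1 s)//= lerDl; apply: sumr_ge0 => t _.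
by rewrite -expr2 sqr_ge0.
Qed.

Lemma weak_ext_deriv_linear j (k : R) (u v : dform R n j) (w z : dform R n j.+1) :
  L2_form Om u -> L2_form Om v -> L2_form Om w -> L2_form Om z ->
  weak_ext_deriv Om u w -> weak_ext_deriv Om v z ->
  weak_ext_deriv Om (k *: u + v) (k *: w + z).
Proof.
move=> uL vL wL zL uw vz f y tf; have [sf _ _] := tf.
(* Smoothness is stated for iterated directional derivatives: the empty list gives [f] itself, a
   one-element list its derivative. *)
have cf : continuous f by have [] := sf [::].
have cDf i : continuous (fun x => 'D_(y i) f x) by have [] := sf [:: y i].
have intD i (a b : dform R n i) t g : L2_form Om a -> L2_form Om b -> continuous g ->
    \int[mu]_(x in Om) (((k *: a + b) x t : R) * g x) =
    k * \int[mu]_(x in Om) ((a x t : R) * g x) + \int[mu]_(x in Om) ((b x t : R) * g x).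
  move=> aL bL cg; rewrite -RintegralZl//; last exact: L2_form_integrable.
  rewrite -RintegralD//; last 2 first.
  - exact: (integrableZl mOm k (L2_form_integrable t aL cg)).
  - exact: L2_form_integrable.
  by apply: eq_Rintegral => x _; rewrite mulrA -mulrDl.
rewrite intD// uw// vz// mulrN -opprD; congr (- _).
rewrite mulr_sumr -big_split/=; apply: eq_bigr => i _.
by rewrite intD// mulrDr mulrCA.
Qed.

Lemma HLambda_linear j (k : R) (u v : dform R n j) :
  HLambda Om u -> HLambda Om v -> HLambda Om (k *: u + v).
Proof.
move=> [uL [w wL uw]] [vL [z zL vz]]; split; first exact: L2_form_linear.
by exists (k *: w + z); [exact: L2_form_linear|exact: weak_ext_deriv_linear].
Qed.

Lemma HLambda0 j : HLambda Om (0 : dform R n j).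
Proof.
have L0 i : L2_form Om (0 : dform R n i).
  split=> [w|]; first exact: measurable_cst.
  rewrite (_ : (\int[_]_(x in _) _ = 0)%E)//; apply: integral0_eq => x _.
  by congr EFin; apply: big1 => s _; rewrite mul0r.
split=> //; exists 0 => // f y _.
rewrite big1 ?oppr0; last first.
  move=> i _; rewrite [X in _ * X](_ : _ = 0) ?mulr0//.
  by rewrite /Rintegral integral0_eq// => x _; rewrite mul0r.
by rewrite /Rintegral integral0_eq// => x _; rewrite mul0r.
Qed.

(** Allows the whole space to be taken as the subspace demanded in (B). *)
Lemma P_Lambda_submod r j Th : submod_closed (mem (P_Lambda r j Om Th) : {pred dform R n j}).
Proof.
split=> [|k u v]; rewrite !inE.
  split; first exact: HLambda0.
  move=> T _; exists 0; last exact: aeW.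
  exact: poly_form_cst.
move=> [uH uP] [vH vP]; split; first exact: HLambda_linear.
exact: piecewise_linear_closed.
Qed.

End HLambda_submodule.

Theorem theorem4p1 (R : realType) (n k : nat) (hk : (1 <= k <= n)%N)
    (Om : set 'rV[R]_n) (hOm : polyhedral_domain Om)
    (I : Type) (Th : I -> {fset {fset 'rV[R]_n}})
    (hmesh : forall h, simplicial_mesh Om (Th h))
    (hreg : shape_regular Th) :
  let V (h : I) : set (dform R n k.-1) := P_Lambda 1 k.-1 Om (Th h) in
  let Vk (h : I) : set (dform R n k) := whitney_Lambda k Om (Th h) in
  let W (h : I) : set (dform R n k.-1) := P0_L2_Lambda k.-1 Om (Th h) in
  (* (A) *)
  (exists M alpha c C : R, [/\ 0 < alpha, 0 < c, 0 < C & forall h : I,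
    [/\ (* bilinearity *)
        (forall (a : R) (s t u : dform R n k.-1), V h s -> V h t -> V h u ->
          form_dot_h (Th h) (a *: s + t) u =
            a * form_dot_h (Th h) s u + form_dot_h (Th h) t u /\
          form_dot_h (Th h) u (a *: s + t) =
            a * form_dot_h (Th h) u s + form_dot_h (Th h) u t),
        (* symmetry *)
        (forall s t : dform R n k.-1, V h s -> V h t ->
          form_dot_h (Th h) s t = form_dot_h (Th h) t s),
        (* boundedness *)
        (forall s t : dform R n k.-1, V h s -> V h t ->
          `|form_dot_h (Th h) s t| <= M * form_norm Om s * form_norm Om t),
        (* coercivity *)
        (forall t : dform R n k.-1, V h t ->
          alpha * form_norm Om t ^+ 2 <= form_dot_h (Th h) t t) &
        (* norm equivalence *)
        (forall t : dform R n k.-1, V h t ->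
          c * form_norm Om t <= form_norm_h (Th h) t <= C * form_norm Om t)]])
  /\
  (* (B) *)
  (exists C : R, forall h : I, exists Vt : set (dform R n k.-1),
    [/\ submod_closed (mem Vt : {pred dform R n k.-1}),
        Vt `<=` V h,
        (forall t t0 : dform R n k.-1, Vt t -> W h t0 ->
          form_dot Om t t0 = form_dot_h (Th h) t t0) &
        exists Pi : dform R n k.-1 -> dform R n k.-1,
          [/\ (forall t, V h t -> Vt (Pi t)),
              (forall (a : R) s t, V h s -> V h t ->
                Pi (a *: s + t) = a *: Pi s + Pi t) &
              forall t, V h t ->
                [/\ ae_eq_form Om (ext_deriv Om (Pi t)) (ext_deriv Om t),
                    form_norm Om (Pi t) <= C * form_norm Om t &
                    forall t0, W h t0 ->
                      form_dot_h (Th h) (Pi t) t0 = form_dot_h (Th h) t t0]]]).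
Proof.
move=> V Vk W; have [_ oOm _ bOm _] := hOm.
have Vlin h a s t : V h s -> V h t -> V h (a *: s + t).
  move=> Vs Vt; have [_ /(_ a s t)] := P_Lambda_submod oOm bOm 1 k.-1 (Th h).
  by rewrite !inE; apply.
have normE h : form_norm Om h ^+ 2 = form_dot Om h h :> R.
  by rewrite sqr_sqrtr// form_dot_ge0.
split; last first.
  exists 1 => h; exists (V h); split => //; first exact: P_Lambda_submod.
    move=> t t0 [[[mt _] _] tP] [[mt0 _] t0P].
    exact: (form_dot_quadrature hOm (hmesh h)).
  by exists id; split => // t Vt; split => //; [exact: aeW|rewrite mul1r].
have [C0 C0_ge0 hC0] := @sum_vertices_sqr_le R n.
(* The added 1 makes the upper constant strictly positive, since [C0] is only known to be
   nonnegative. *)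
pose C := C0 + 1; have C_gt0 : 0 < C by rewrite ltr_wpDl.
have hle h t : V h t -> form_dot Om t t <= form_dot_h (Th h) t t.
  by move=> [[[mt _] _] tP]; exact: (form_dot_le_h hOm (hmesh h)).
have hge h t : V h t -> form_dot_h (Th h) t t <= C * form_dot Om t t.
  move=> [[[mt _] _] tP].
  apply: le_trans (form_dot_h_le hOm (hmesh h) hC0 (conj mt tP)) _.
  by rewrite ler_wpM2r ?form_dot_ge0// lerDl.
have hnorm h t : V h t -> form_norm_h (Th h) t <= Num.sqrt C * form_norm Om t.
  move=> Vt; rewrite /form_norm_h /form_norm -sqrtrM ?(ltW C_gt0)//.
  exact/ler_wsqrtr/hge.
have sTh h T : T \in Th h -> nsimplex T by have [+ _ _] := hmesh h; apply.
(* Both lower constants are 1 because the lumped norm dominates the L^2 norm. *)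
exists C, 1, 1, (Num.sqrt C); split; rewrite ?sqrtr_gt0// => h; split.
- move=> a s t u [_ sP] [_ tP] [_ uP]; split.
    by rewrite form_dot_h_linear//; exact: sTh.
  rewrite form_dot_hC form_dot_h_linear//; last exact: sTh.
  by rewrite !(form_dot_hC _ u).
- by move=> s t _ _; exact: form_dot_hC.
- move=> s t Vs Vt.
  (* Cauchy-Schwarz for the lumped form; each of the two lumped norms then costs a factor sqrt C,
     which makes C the bound. *)
  apply: (@le_trans _ _ (form_norm_h (Th h) s * form_norm_h (Th h) t)).
    rewrite -sqrtrM ?form_dot_h_ge0// -sqrtr_sqr ler_wsqrtr//.
    exact: (form_dot_h_sqr_le (hmesh h) Vs.2 Vt.2).
  apply: le_trans (ler_pM (sqrtr_ge0 _) (sqrtr_ge0 _) (hnorm h s Vs) (hnorm h t Vt)) _.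
  by rewrite mulrACA -expr2 sqr_sqrtr ?(ltW C_gt0)// mulrA.
- by move=> t Vt; rewrite mul1r normE; exact: hle.
- move=> t Vt; rewrite mul1r hnorm// andbT.
  exact/ler_wsqrtr/hle.
Qed.
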